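(* Let $d\ge 3$ be an odd integer. For every $n\ge 1$, the rank of the group $E_n^2(d)$ is $2$. Additionally, $E_n^2(d)$ has a unique chief series.
   Context: The rank $d(G)$ of a group $G$ is the minimum cardinality of a generating set of $G$. A chief series of a finite group $G$ is a sequence $1=N_1\triangleleft N_2\triangleleft\cdots\triangleleft N_k=G$ of normal subgroups of $G$ such that each $N_{i+1}/N_i$ is a minimal normal subgroup of $G/N_i$. $T_n(d)$ is the rooted $d$-ary tree with $n$ levels ($d^k$ vertices at level $k$ for $0\le k\le n$; every non-leaf vertex has $d$ children), and $\mathrm{Aut}(T_n(d))$ is its group of rooted automorphisms. For $m\le n$, $\mathrm{res}_m:\mathrm{Aut}(T_n(d))\to\mathrm{Aut}(T_m(d))$ is restriction to the first $m$ levels, $\mathrm{sgn}$ on $\mathrm{Aut}(T_m(d))$ is the sign of the induced permutation of the $d^m$ leaves, and $\mathrm{sgn}_m=\mathrm{sgn}\circ\mathrm{res}_m$. Identify $\mathrm{Aut}(T_n(d))\cong\mathrm{Aut}(T_{n-1}(d))\wr\mathrm{Aut}(T_1(d))$, where an element $((b_i)_i;a)$ consists of $a=$ its action on the $d$ vertices of level $1$ and of elements $b_i\in\mathrm{Aut}(T_{n-1}(d))$ describing the action on the $d$ subtrees below them. For odd $d$, define $E_1^2(d)=\mathrm{Aut}(T_1(d))=S_d$ and, for $n\ge 2$, $$E_n^2(d)=\bigl(E_{n-1}^2(d)\wr\mathrm{Aut}(T_1(d))\bigr)\cap\ker(\mathrm{sgn}_2)\subseteq \mathrm{Aut}(T_n(d)).$$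 *)

(* Defs.v *)
From mathcomp Require Import all_boot all_fingroup all_solvable.
Set Implicit Arguments.
Unset Strict Implicit.
Unset Printing Implicit Defensive.

Import GroupScope.

(* The vertices of the rooted d-ary tree T_n(d) are the words of length at    *)
(* most n over 'I_d: the root is the empty word, the level of a word is its   *)
(* size, and the children of u are the words rcons u i.                       *)
Notation vertex d n := (n.-bseq 'I_d).

Definition adj d (u v : seq 'I_d) : bool :=
  [exists i : 'I_d, (v == rcons u i) || (u == rcons v i)].

Definition autT d n : {set {perm vertex d n}} :=
  [set g : {perm vertex d n} | (g [bseq] == [bseq])
     && [forall u : vertex d n, forall v : vertex d n, adj (g u) (g v) == adj u v]].

(* This is only meaningful for m <= n and g \in autT d n, see resE below;     *)
(* insubd 1 supplies the (unused) value 1 when the map is not injective.      *)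
Definition res d n m (g : {perm vertex d n}) : {perm vertex d m} :=
  insubd (1 : {perm vertex d m})
    [ffun u : vertex d m => insub_bseq m (g (insub_bseq n u))].

(* The sign is a boolean, true for odd permutations.                          *)
Definition sgn d m (g : {perm vertex d m}) : bool :=
  odd_perm (restr_perm [set u : vertex d m | size u == m] g).

Definition sgn_at d n m (g : {perm vertex d n}) : bool := sgn (res m g).

Definition ker_sgn d n m : {set {perm vertex d n}} :=
  [set g in autT d n | ~~ sgn_at m g].

(* The element ((b_i)_i; a) of Aut(T_n(d)) wr Aut(T_1(d)), as an automorphism *)
(* of T_(n+1)(d): it fixes the root and maps i :: w to a i :: b i w.          *)
Definition wr_fun d n (b : 'I_d -> {perm vertex d n}) (a : 'S_d)
    (u : vertex d n.+1) : vertex d n.+1 :=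
  insub_bseq n.+1 (if val u is i :: w then a i :: b i (insub_bseq n w) else [::]).

Lemma val_insub_bseq n T (s : seq T) : size s <= n -> insub_bseq n s = s :> seq T.
Proof. by move=> le_sn; rewrite /insub_bseq val_insubd le_sn. Qed.

Lemma insub_bseqK n T (u : n.-bseq T) : insub_bseq n u = u.
Proof. by apply: val_inj; rewrite /= val_insub_bseq ?size_bseq. Qed.

Lemma val_wr_fun d n (b : 'I_d -> {perm vertex d n}) (a : 'S_d) u :
  wr_fun b a u = (if val u is i :: w then a i :: b i (insub_bseq n w) else [::])
    :> seq 'I_d.
Proof. by apply: val_insub_bseq; case: (val u) => //= i w; apply: size_bseq. Qed.

Lemma wr_fun_inj d n (b : 'I_d -> {perm vertex d n}) (a : 'S_d) :
  injective (wr_fun b a).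
Proof.
move=> u v /(congr1 val); rewrite /= !val_wr_fun => E; apply: val_inj => /=.
case: u v E => [[|i u] Hu] [[|j v] Hv] //= [/perm_inj eij].
rewrite -{}eij => /val_inj/perm_inj/(congr1 val).
by rewrite /= !val_insub_bseq // => ->.
Qed.

Definition wr d n (b : 'I_d -> {perm vertex d n}) (a : 'S_d) :
  {perm vertex d n.+1} := perm (@wr_fun_inj d n b a).

Definition wreath d n (H : {set {perm vertex d n}}) : {set {perm vertex d n.+1}} :=
  [set wr b a | b : {ffun 'I_d -> {perm vertex d n}} in ffun_on (mem H),
                a : 'S_d].

(* E d n is E_n^2(d) for 1 <= n; the value at 0 is irrelevant.                *)
Fixpoint E d n : {set {perm vertex d n}} :=
  match n with
  | 0 => autT d 0
  | m.+1 => if m == 0%N then autT d m.+1 else wreath (E d m) :&: ker_sgn d m.+1 2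
  end.

(* The sequence s = [:: N_1; ...; N_k].                                       *)
Definition is_chief_series (gT : finGroupType) (G : {group gT})
    (s : seq {group gT}) : bool :=
  if s is N1 :: s' then
    [&& N1 == 1%G, last N1 s' == G, all (fun N : {group gT} => N <| G) s
      & path (fun V U : {group gT} => (V <| U) && minnormal (U / V) (G / V)) N1 s']
  else false.

Lemma is_chief_seriesE (gT : finGroupType) (G N : {group gT}) s :
  is_chief_series G (N :: s) =
  [&& N == 1%G, (G.-chief).-series N s & last N s == G].
Proof.
rewrite /=; case: (N =P 1%G) => //= ->; rewrite normal1 /= andbC; congr (_ && _).
have: 1%G <| G by apply: normal1.
elim: s {N}1%G => //= U s IHs V nVG.
have -> : chief_factor G V U =
    [&& U <| G, V <| U & minnormal (U / V) (G / V)].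
  rewrite /chief_factor andbC; case nUG: (U <| G) => //=.
  apply/idP/andP => [maxV | [nVU minUV]].
    have /andP[/proper_sub sVU _] := maxgroupp maxV; split.
      exact: normalS sVU (normal_sub nUG) nVG.
    by apply: chief_factor_minnormal; rewrite /chief_factor maxV.
  by apply: minnormal_maxnormal; rewrite ?(normal_norm nVG).
case nUG: (U <| G) => //=; rewrite -IHs //.
by rewrite andbCA.
Qed.

Section Automorphisms.

Variable d : nat.
Implicit Types (n m : nat).

Lemma autTP n (g : {perm vertex d n}) :
  reflect (g [bseq] = [bseq] /\ forall u v, adj (g u) (g v) = adj u v)
          (g \in autT d n).
Proof.
rewrite inE; apply: (iffP andP) => [[/eqP g0 /'forall_'forall_eqP]|[-> H]] //.
by split=> //; apply/'forall_'forall_eqP.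
Qed.

Lemma group_set_autT n : group_set (autT d n).
Proof.
apply/group_setP; split=> [|g h /autTP[g0 gE] /autTP[h0 hE]].
  by apply/autTP; split=> [|u v]; rewrite !perm1.
by apply/autTP; split=> [|u v]; rewrite !permM ?g0 // hE.
Qed.
Canonical autT_group n := Group (group_set_autT n).

Lemma autT_child n (g : {perm vertex d n}) (u v : vertex d n) i :
  g \in autT d n -> val v = rcons u i -> exists j, val (g v) = rcons (g u) j.
Proof.
case/autTP=> g0 gE; have [k] := ubnP (size u).
elim: k u v i => // k IHk u v i /ltnSE le_uk def_v.
have /existsP[j]: adj (g u) (g v).
  by rewrite gE; apply/existsP; exists i; rewrite def_v eqxx.
case/orP=> /eqP Ej; first by exists j.
have [s def_u] : exists s, val u = s by exists (val u).
case/lastP: s def_u => [|w l] def_u.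
  have u0: u = [bseq] by apply: val_inj.
  by move/(congr1 size): Ej; rewrite u0 g0 size_rcons.
have le_wn: size w <= n.
  by rewrite (leq_trans _ (size_bseq u)) // def_u size_rcons.
pose w' : vertex d n := insub_bseq n w.
have def_w: val w' = w by rewrite /= val_insub_bseq.
have [||j' Ej'] := IHk w' u l.
- by rewrite def_w (leq_trans _ le_uk) // def_u size_rcons.
- by rewrite def_w.
move: Ej; rewrite Ej' => /rcons_inj[/val_inj/perm_inj eq_w' _].
move/(congr1 size): def_v; rewrite def_u -eq_w' def_w !size_rcons => /eqP.
by rewrite -addn2 -{1}[size w]addn0 eqn_add2l.
Qed.

Lemma size_autT n (g : {perm vertex d n}) u : g \in autT d n -> size (g u) = size u.
Proof.
move=> Ag; have [k] := ubnP (size u); elim: k u => // k IHk u /ltnSE le_uk.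
have [s def_u] : exists s, val u = s by exists (val u).
case/lastP: s def_u => [|w l] def_u.
  by rewrite (_ : u = [bseq]); [have /autTP[-> _] := Ag | apply: val_inj].
have lt_wn: size w < n by rewrite -(size_rcons w l) -def_u size_bseq.
pose w' : vertex d n := insub_bseq n w.
have def_w: val w' = w by rewrite /= val_insub_bseq // ltnW.
have [|j ->] := @autT_child n g w' u l Ag; first by rewrite def_w.
rewrite size_rcons IHk ?def_w ?def_u ?size_rcons //.
by rewrite (leq_trans _ le_uk) // def_u size_rcons.
Qed.

Lemma resE n m (g : {perm vertex d n}) u :
  m <= n -> g \in autT d n -> res m g u = g (insub_bseq n u) :> seq 'I_d.
Proof.
move=> le_mn Ag; have le_un v : size (val (v : vertex d m)) <= n.
  exact: leq_trans (size_bseq v) le_mn.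
have vE v : val (insub_bseq m (g (insub_bseq n (val (v : vertex d m))))) =
    val (g (insub_bseq n v)).
  by rewrite /= val_insub_bseq // size_autT // val_insub_bseq ?size_bseq ?(le_un v).
rewrite -pvalE /res val_insubd ifT ?ffunE ?vE //.
apply/injectiveP=> v w; rewrite !ffunE => /(congr1 val).
rewrite !vE => /val_inj/perm_inj/(congr1 val) /=.
by rewrite !val_insub_bseq ?(le_un v) ?(le_un w) // => /val_inj.
Qed.

Lemma res_autT n m (g : {perm vertex d n}) :
  m <= n -> g \in autT d n -> res m g \in autT d m.
Proof.
move=> le_mn Ag; have /autTP[g0 gE] := Ag; apply/autTP; split=> [|u v].
  apply: val_inj; rewrite /= resE // (_ : insub_bseq n _ = [bseq]) ?g0 //.
  by apply: val_inj; rewrite /= val_insub_bseq.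
by rewrite !resE // gE !val_insub_bseq // (leq_trans (size_bseq _)).
Qed.

Lemma resM n m : m <= n -> {in autT d n &, {morph @res d n m : g h / g * h}}.
Proof.
move=> le_mn g h Ag Ah; apply/permP=> u; apply: val_inj.
by rewrite permM /= !resE ?groupM // permM insub_bseqK.
Qed.

Lemma sgnM m : {in autT d m &, {morph @sgn d m : g h / g * h >-> g (+) h}}.
Proof.
have nL g : g \in autT d m -> g \in 'N([set u : vertex d m | size u == m] | 'P).
  move=> Ag; apply/astabsP=> u.
  by rewrite !inE /= /aperm size_autT.
by move=> g h Ag Ah; rewrite /sgn morphM ?nL // odd_permM.
Qed.

Lemma group_set_ker_sgn n m : m <= n -> group_set (ker_sgn d n m).
Proof.
move=> le_mn; have sM : {in autT d n &,
    {morph @sgn_at d n m : g h / g * h >-> g (+) h}}.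
  by move=> g h Ag Ah; rewrite /sgn_at resM // sgnM ?res_autT.
apply/group_setP; split=> [|g h].
  rewrite inE group1 /=; have := sM _ _ (group1 _) (group1 _).
  by rewrite mulg1 => ->; rewrite addbb.
move=> /setIdP[Ag sg] /setIdP[Ah sh]; apply/setIdP; split; first exact: groupM.
by rewrite sM // (negPf sg) (negPf sh).
Qed.

Lemma wrE n (b : 'I_d -> {perm vertex d n}) (a : 'S_d) (u : vertex d n.+1) :
  wr b a u = (if val u is i :: w then a i :: b i (insub_bseq n w) else [::])
    :> seq 'I_d.
Proof. by rewrite permE val_wr_fun. Qed.

Lemma wrM n (b b' : 'I_d -> {perm vertex d n}) (a a' : 'S_d) :
  wr b a * wr b' a' = wr (fun i => b i * b' (a i)) (a * a').
Proof.
apply/permP=> u; apply: val_inj; rewrite permM /= wrE /= !wrE.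
by case: (val u) => //= i w; rewrite !permM insub_bseqK.
Qed.

Lemma eq_wr n (b b' : 'I_d -> {perm vertex d n}) (a : 'S_d) :
  b =1 b' -> wr b a = wr b' a.
Proof.
move=> eq_b; apply/permP=> u; apply: val_inj; rewrite /= !wrE.
by case: (val u) => //= i w; rewrite eq_b.
Qed.

Lemma wreathP n (H : {set {perm vertex d n}}) g :
  reflect (exists b : 'I_d -> {perm vertex d n}, exists a : 'S_d,
             (forall i, b i \in H) /\ g = wr b a)
          (g \in wreath H).
Proof.
apply: (iffP imset2P) => [[b a /ffun_onP Hb _ ->]|[b [a [Hb ->]]]].
  by exists b, a.
exists (finfun b) a; rewrite ?inE //; first by apply/ffun_onP=> i; rewrite ffunE.
by apply: eq_wr => i; rewrite ffunE.
Qed.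

Lemma group_set_wreath n (H : {group {perm vertex d n}}) : group_set (wreath H).
Proof.
apply/group_setP; split=> [|g h].
  apply/wreathP; exists (fun=> 1), 1; split=> //; apply/permP=> u; apply: val_inj.
  rewrite perm1 /= wrE; case: u => -[|i w] //= lew.
  by rewrite !perm1 val_insub_bseq.
case/wreathP=> b [a [Hb ->]] /wreathP[b' [a' [Hb' ->]]]; rewrite wrM.
apply/wreathP; exists (fun i => b i * b' (a i)), (a * a').
by split=> // i; rewrite groupM.
Qed.

Lemma adj_cons (i j : 'I_d) (u v : seq 'I_d) :
  adj (i :: u) (j :: v) = (i == j) && adj u v.
Proof.
apply/existsP/andP=> [[k]|[/eqP-> /existsP[k]]].
  rewrite !rcons_cons !eqseq_cons => /orP[] /andP[/eqP-> Ek]; split=> //;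
  by apply/existsP; exists k; rewrite Ek ?orbT.
by exists k; rewrite !rcons_cons !eqseq_cons eqxx.
Qed.

Lemma adj_sym (u v : seq 'I_d) : adj u v = adj v u.
Proof. by apply: eq_existsb => i; rewrite orbC. Qed.

Lemma adj_nil (u : seq 'I_d) : adj [::] u = (size u == 1%N).
Proof.
apply/existsP/idP=> [[i /orP[/eqP-> //|]]|].
  by case: u.
by case: u => [|i []] //= _; exists i; rewrite eqxx.
Qed.

Lemma wreath_autT n : wreath (autT d n) = autT d n.+1.
Proof.
apply/setP=> g; apply/wreathP/idP=> [[b [a [Ab ->]]]|Ag].
  apply/autTP; split=> [|u v]; first by apply: val_inj; rewrite /= wrE.
  rewrite !wrE; case: u v => [[|i u] Hu] [[|j v] Hv] //=.
  - by rewrite !adj_nil /= size_autT // val_insub_bseq.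
  - by rewrite ![adj _ [::]]adj_sym !adj_nil /= size_autT // val_insub_bseq.
  rewrite !adj_cons (inj_eq perm_inj); case: eqP => //= <-.
  by have /autTP[_ ->] := Ab i; rewrite !val_insub_bseq.
have /autTP[g0 gE] := Ag.
pose top i : vertex d n.+1 := [bseq of [:: i]].
pose ext i (w : vertex d n) : vertex d n.+1 := [bseq of i :: w].
have stop i : size (g (top i)) = 1%N by rewrite size_autT.
pose a0 i := head i (g (top i)).
have topE i : val (g (top i)) = [:: a0 i].
  by rewrite /a0 /=; case: (bseqval (g _)) (stop i) => [|? []].
have a0_inj : injective a0.
  move=> i j eij; have: g (top i) = g (top j).
    by apply: val_inj; rewrite !topE eij.
  by move/perm_inj/(congr1 val) => [].
have headE i w : val (g (ext i w)) = a0 i :: behead (g (ext i w)).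
  have [k] := ubnP (size w); elim: k w => // k IHk w /ltnSE le_wk.
  have [s def_w] : exists s, val w = s by exists (val w).
  case/lastP: s def_w => [|w' l] def_w.
    by rewrite (_ : ext i w = top i) ?topE //; apply: val_inj; rewrite /= def_w.
  have lt_wn: size w' < n by rewrite -(size_rcons w' l) -def_w size_bseq.
  pose w1 : vertex d n := insub_bseq n w'.
  have def_w1: val w1 = w' by rewrite /= val_insub_bseq // ltnW.
  have [|j Ej] := @autT_child _ g (ext i w1) (ext i w) l Ag.
    by rewrite /= def_w def_w1.
  rewrite /= in Ej; rewrite /= Ej (IHk w1) ?rcons_cons //.
  by rewrite -/(val w1) def_w1 (leq_trans _ le_wk) // def_w size_rcons.
have tailE i w : val (insub_bseq n (behead (g (ext i w)))) = behead (g (ext i w)).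
  rewrite /= val_insub_bseq // size_behead.
  by case: (size (g (ext i w))) (size_bseq (g (ext i w))).
have b0_inj i : injective (fun w => insub_bseq n (behead (g (ext i w)))).
  move=> w w' /(congr1 val); rewrite !tailE => Eb.
  have: g (ext i w) = g (ext i w') by apply: val_inj; rewrite headE Eb -headE.
  by move/perm_inj/(congr1 val) => [] /val_inj.
exists (fun i => perm (b0_inj i)), (perm a0_inj); split=> [i|]; last first.
  apply/permP=> u; apply: val_inj; rewrite /= wrE.
  case def_u: (val u) => [|i w]; first by rewrite (_ : u = [bseq]) ?g0 //; apply: val_inj.
  have le_wn: size w <= n by have := size_bseq u; rewrite def_u.
  rewrite !permE tailE -headE; congr (val (g _)).
  by apply: val_inj; rewrite /= def_u val_insub_bseq.
apply/autTP; split=> [|u v]; rewrite !permE.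
  by apply: val_inj; rewrite tailE (_ : ext i _ = top i) ?topE //; apply: val_inj.
have := gE (ext i u) (ext i v).
by rewrite headE (headE i v) /= !adj_cons !eqxx /= !tailE.
Qed.

Lemma group_set_E n : group_set (E d n).
Proof.
elim: n => [|[|n] IHn]; try exact: group_set_autT.
have := @group_set_ker_sgn n.+2 2 isT => gK.
exact: (group_setI (Group (group_set_wreath (Group IHn))) (Group gK)).
Qed.
Canonical E_group n := Group (group_set_E n).

End Automorphisms.

(* Main.v *)
Require Import Defs.
From mathcomp Require Import all_boot all_fingroup all_solvable.
From mathcomp Require Import zify.
Set Implicit Arguments.
Unset Strict Implicit.
Unset Printing Implicit Defensive.
Import GroupScope.

(** As d is odd, the sign of ((b_i); a) on the second level is the product of
    sgn(a) and of the signs s(b_i) of the b_i on their own first level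
    [sgn_at2_wr]: the factor sgn(a) arises d times. So E_(n+1) is built from
    G = E_n and its sign s as the even wreath product
      W = { ((b_i); a) : b_i in G, prod_i s(b_i) = sgn(a) },
    and the theorem is an induction in which (G, s) is replaced by W and the sign
    of its action on the first level. Write K for the kernel of s and B for the
    kernel of the action of W on the first level.

    A chief series is unique as soon as the normal subgroups form a chain. For
    this to be inherited by W, the induction also carries that N = [N, G] for
    every proper normal subgroup N of G, all of which lie in K. Commutators with
    elements of W that repeat one element of G at two vertices isolate a single
    vertex, since there are at least three vertices on the first level. Hence:
    - a normal subgroup of W that moves the first level contains [[K, G], G] = K
      at each vertex. Modulo K^d the group B is the even-weight submodule of
      F_2^d, which is irreducible because d is odd, so all of B is obtained; and
      the nontrivial normal subgroups of W / B = S_d are A_d and S_d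
      [ker_top_sub_normal, onto_sym_normal];
    - a normal subgroup N of W inside B, with projection P to a vertex, contains
      [[P, G], G] at each vertex; so N is P^d if P is proper, and B otherwise
      [normal_in_ker_top].
    The normal subgroups of W are thus W, the kernel of its sign, B, and the P^d
    for P a proper normal subgroup of G.

    For the rank, let w and y generate G, with w an odd involution and y acting
    as a rotation on the first level. Two elements of the same kind generate W:
    the transposition (0 1) with w placed at the vertex 2, and the rotation with
    y placed at 0. Their product fixes 0 and permutes the other vertices in a
    cycle of length d - 1, meeting w once; so its power of exponent 2 (d - 1) is
    supported at 0, with value y^(2 (d - 1)). That value still moves the first
    level of its subtree, as d >= 3 does not divide 2 (d - 1); its conjugates then
    yield K at each vertex, and irreducibility yields B [even_wreath_gen]. *)

(** * Symmetric groups of odd degree *)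

Section SymmetricGroup.

Variable T : finType.
Implicit Types (s t : {perm T}) (N : {group {perm T}}).

Lemma perm_map_uniq (xs ys : seq T) :
  uniq xs -> uniq ys -> size xs = size ys -> exists s, map s xs = ys.
Proof.
elim: xs ys => [|x xs IHxs] [|y ys] //=; first by exists 1.
case/andP=> xs'x Uxs /andP[ys'y Uys] [eq_sz].
have [s def_ys] := IHxs ys Uxs Uys eq_sz.
exists (s * tperm (s x) y); rewrite permM tpermL; congr (_ :: _).
rewrite -def_ys in ys'y *; apply/eq_in_map=> z xs_z; rewrite permM tpermD //.
  by rewrite (inj_eq perm_inj); apply: contraNneq xs'x => ->.
by apply: contraNneq ys'y => ->; apply: map_f.
Qed.

Lemma perm_map2 (x y x' y' : T) :
  x != y -> x' != y' -> exists s, s x = x' /\ s y = y'.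
Proof.
move=> nxy nxy'; have [||//|s [<- <-]] := @perm_map_uniq [:: x; y] [:: x'; y'].
- by rewrite /= inE nxy.
- by rewrite /= inE nxy'.
by exists s.
Qed.

Lemma exists_notin (xs : seq T) : size xs < #|T| -> exists z, z \notin xs.
Proof.
move=> lt_xs; apply/existsP; rewrite -negb_forall; apply: contraL lt_xs.
move/forallP=> xsT; rewrite -leqNgt cardE.
by apply: uniq_leq_size (enum_uniq _) _ => z _.
Qed.

Hypotheses (T_ge3 : 2 < #|T|) (T_odd : odd #|T|).

(** For u in N, the product of the transpositions (u i, u k) and (i k) is a
    commutator in N. Some choice of k makes them share a point, unless u swaps
    i and j and takes k to a fourth point. Then the degree, being odd, leaves a
    fifth point l, and conjugating by (k l) cancels one of the two factors; in
    degree four this is where the Klein group would appear. *)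
Lemma normal_has_3cycle N : [set: {perm T}] \subset 'N(N) -> N != 1%G ->
  exists x y z, uniq [:: x; y; z] /\ tperm x y * tperm x z \in N.
Proof.
move=> nN /trivgPn[u Nu ntu].
have nNJ s t : s \in N -> s ^ t \in N.
  by move=> Ns; rewrite memJ_norm // (subsetP nN) ?inE.
have Ncomm i k : tperm (u i) (u k) * tperm i k \in N.
  have: u^-1 * u ^ tperm i k \in N by rewrite groupM ?groupV ?nNJ.
  by rewrite -tpermJ !conjgE !mulgA tpermV.
have [i ui]: exists i, u i != i.
  apply/existsP; rewrite -negb_forall; apply: contra ntu => /forallP u1.
  by apply/eqP/permP=> i; rewrite perm1; apply/eqP.
pose j := u i; have nji: j != i by [].
have nuj: u j != j by rewrite (inj_eq perm_inj).
have [uji | nuji] := eqVneq (u j) i; last first.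
  exists j, (u j), i; rewrite /= !inE negb_or (eq_sym j) nuj nji nuji; split=> //.
  by rewrite [tperm j i]tpermC; apply: Ncomm.
have [k] := @exists_notin [:: i; j] T_ge3; rewrite !inE negb_or => /andP[nki nkj].
have nuki: u k != i by rewrite -uji (inj_eq perm_inj).
have nukj: u k != j by rewrite (inj_eq perm_inj).
have [ukk | nukk] := eqVneq (u k) k.
  exists k, j, i; rewrite /= !inE negb_or nkj nki nji; split=> //.
  by have := Ncomm i k; rewrite ukk ![tperm k _]tpermC.
set m := u k in nuki nukj nukk.
have T_ge5: 4 < #|T|.
  have: uniq [:: i; j; k; m] by rewrite /= !inE !negb_or !(eq_sym i) nji nki nuki
      (eq_sym j k) nkj (eq_sym j m) nukj (eq_sym k) nukk.
  move/card_uniqP; have := max_card [in [:: i; j; k; m]] => /[swap] -> /=.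
  by rewrite leq_eqVlt => /predU1P[eqT|//]; move: T_odd; rewrite -eqT.
have [l] := @exists_notin [:: i; j; k; m] T_ge5.
rewrite !inE !negb_or => /and4P[nli nlj nlk nlm].
exists i, k, l; rewrite /= !inE !negb_or !(eq_sym i) nki nli (eq_sym k) nlk.
split=> //; have := Ncomm i k; rewrite -/j -/m => Ne.
have: (tperm j m * tperm i k)^-1 * (tperm j m * tperm i k) ^ tperm k l \in N.
  by rewrite groupM ?groupV ?nNJ.
rewrite conjMg !tpermJ tpermL (tpermD nkj nlj) (tpermD (_ : k != m) nlm) 1?eq_sym //.
by rewrite (tpermD nki nli) invMg !tpermV -!mulgA tpermKg.
Qed.

(** Any two transpositions are congruent modulo N: if they share a point, by
    conjugating the 3-cycle of N; otherwise through a transposition that meets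
    both. *)
Lemma tperm2_in_normal N : [set: {perm T}] \subset 'N(N) -> N != 1%G ->
  forall a b c e, a != b -> c != e -> tperm a b * tperm c e \in N.
Proof.
move=> nN ntN; have [x [y [z [Uxyz Nxyz]]]] := normal_has_3cycle nN ntN.
have N3 a b c : b != a -> c != a -> b != c -> tperm a b * tperm a c \in N.
  move=> nba nca nbc.
  have [||s [<- <- <-]] := @perm_map_uniq [:: x; y; z] [:: a; b; c] Uxyz => //.
    by rewrite /= !inE negb_or (eq_sym a) nba (eq_sym a) nca nbc.
  by rewrite -!tpermJ -conjMg memJ_norm // (subsetP nN) ?inE.
have N3' a b c : b != a -> c != a -> tperm a b * tperm a c \in N.
  by move=> nb nc; have [->|] := eqVneq b c; [rewrite tperm2 group1 | apply: N3].
move=> a b c e nab nce; rewrite eq_sym in nab; rewrite eq_sym in nce.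
have [ca | nca] := eqVneq c a; first by rewrite ca N3' // -ca.
have -> : tperm a b * tperm c e = (tperm a b * tperm a c) * (tperm c a * tperm c e).
  by rewrite mulgA (tpermC c a) -(mulgA (tperm a b)) tperm2 mulg1.
by apply: groupM; apply: N3' => //; rewrite eq_sym.
Qed.

Lemma even_in_normal N : [set: {perm T}] \subset 'N(N) -> N != 1%G ->
  forall s, ~~ odd_perm s -> s \in N.
Proof.
move=> nN ntN s; have [ts -> dts] := prod_tpermP s.
have N2 := tperm2_in_normal nN ntN.
have nNJ u t : u \in N -> u ^ t \in N.
  by move=> Nu; rewrite memJ_norm // (subsetP nN) ?inE.
rewrite odd_perm_prod //.
suff: if odd (size ts) then
        forall c e, c != e -> \prod_(t <- ts) tperm t.1 t.2 * tperm c e \in N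
      else \prod_(t <- ts) tperm t.1 t.2 \in N by case: ifP.
elim: ts dts => [_|[a b] ts IHts] /=; first by rewrite big_nil group1.
case/andP=> /= nab /IHts{IHts}; rewrite big_cons /=; case: ifP => /= _ Nts.
  by have := nNJ _ (tperm a b) (Nts a b nab); rewrite conjgE !mulgA -mulgA tperm2 mulg1 tpermV.
move=> c e nce; have := groupM (N2 a b c e nab nce) (nNJ _ (tperm c e) Nts).
by rewrite conjgE tpermV -!mulgA (mulgA (tperm c e)) tperm2 mul1g.
Qed.

(** The second permutation has to be odd in degree three, where the even
    permutations commute. *)
Lemma exists_noncentral_even : exists s t : {perm T}, ~~ odd_perm s /\ [~ s, t] != 1.
Proof.
have [x _] := @exists_notin [::] (ltn_trans (isT : 0 < 2) T_ge3).
have [y] := @exists_notin [:: x] (ltnW T_ge3); rewrite inE => nyx.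
have [z] := @exists_notin [:: x; y] T_ge3; rewrite !inE negb_or => /andP[nzx nzy].
exists (tperm x y * tperm x z), (tperm x y).
split; first by rewrite odd_mul_tperm odd_tperm !(eq_sym x) nyx nzx.
apply/commgP => /(congr1 (fun p : {perm T} => p x)) /eqP; apply/negP.
rewrite !permM tpermL tpermR tpermL (_ : tperm x z y = y) ?tpermR 1?eq_sym //.
by rewrite tpermD 1?eq_sym // eq_sym.
Qed.

End SymmetricGroup.

(** * Sign homomorphisms and surjections onto a symmetric group *)

(** A set and not the kernel of a morphism: s is defined on the whole type, and only
    multiplicative on G. *)
Definition even_part (gT : finGroupType) (G : {set gT}) (s : gT -> bool) : {set gT} :=
  [set x in G | ~~ s x].

Section EvenPart.

Variables (gT : finGroupType) (G : {group gT}) (s : gT -> bool).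
Hypothesis sM : {in G &, {morph s : x y / x * y >-> x (+) y}}.

Lemma sgn_morph1 : s 1 = false.
Proof. by have := sM (group1 G) (group1 G); rewrite mulg1 addbb. Qed.

Lemma sgn_morphV : {in G, {morph s : x / x^-1 >-> x}}.
Proof.
move=> x Gx; have := sM Gx (groupVr Gx); rewrite mulgV sgn_morph1.
by case: (s x); case: (s x^-1).
Qed.

Lemma sgn_morphJ : {in G &, forall x y, s (x ^ y) = s x}.
Proof.
by move=> x y Gx Gy; rewrite conjgE !sM ?groupM ?groupV // sgn_morphV // addbC addbK.
Qed.

Lemma group_set_even : group_set (even_part G s).
Proof.
apply/group_setP; split=> [|x y]; rewrite !inE ?group1 ?sgn_morph1 //.
by case/andP=> Gx /negPf s_x /andP[Gy /negPf s_y]; rewrite groupM // sM // s_x s_y.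
Qed.

Lemma even_part_normal : even_part G s <| G.
Proof.
apply/andP; split; first by apply/subsetP=> x /setIdP[].
apply/subsetP=> y Gy; rewrite inE; apply/subsetP=> _ /imsetP[x /setIdP[Gx s_x] ->].
by rewrite inE groupJ // sgn_morphJ.
Qed.

Lemma normal_above_even (N : {group gT}) :
  N <| G -> even_part G s \subset N -> N = G :> {set gT} \/ N = even_part G s :> {set gT}.
Proof.
move=> /andP[/subsetP sNG _] /subsetP sKN.
have [/subsetP sNK | ] := boolP (N \subset even_part G s).
  by right; apply/setP=> x; apply/idP/idP=> [/sNK|/sKN].
case/subsetPn=> y Ny; have Gy := sNG y Ny; rewrite inE Gy negbK => s_y; left.
apply/setP=> x; apply/idP/idP=> [/sNG //|Gx].
have [s_x | s'x] := boolP (s x); last by rewrite sKN // inE Gx.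
rewrite -(groupMr x Ny) sKN // inE groupM //=.
by rewrite sM // s_x s_y.
Qed.

End EvenPart.

Section OntoSym.

Variables (T : finType) (gT : finGroupType) (G : {group gT}).
Variable f : {morphism G >-> {perm T}}.
Hypotheses (T_ge3 : 2 < #|T|) (T_odd : odd #|T|) (f_onto : f @* G = [set: {perm T}]).

Let s x := odd_perm (f x).

Lemma odd_morph : {in G &, {morph s : x y / x * y >-> x (+) y}}.
Proof. by move=> x y Gx Gy; rewrite /s morphM // odd_permM. Qed.

(** The image of N is normal and nontrivial, so it contains the alternating
    group, and N is a union of cosets of the kernel. *)
Lemma onto_sym_normal (N : {group gT}) : N <| G ->
  ~~ (N \subset 'ker f) -> 'ker f \subset N -> even_part G s \subset N.
Proof.
move=> nsNG NnB sBN; have sNG := normal_sub nsNG.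
have nfN : [set: {perm T}] \subset 'N(f @* N).
  by rewrite -f_onto; case/andP: (morphim_normal f nsNG).
have ntN : (f @* N)%G != 1%G.
  apply: contra NnB => /eqP/(congr1 val) /= fN1; apply/subsetP=> x Nx.
  have Gx := subsetP sNG x Nx; have: f x \in f @* N by apply: mem_morphim.
  by rewrite fN1 => /set1P fx1; apply/kerP.
apply/subsetP=> x /setIdP[Gx even_x].
have /morphimP[y Gy Ny fxy] := even_in_normal T_ge3 T_odd nfN ntN even_x.
rewrite -(mulgKV y x) groupM // (subsetP sBN) // !inE groupM ?groupV //=.
by rewrite morphM ?groupV // morphV // fxy mulgV.
Qed.

(** The commutator subgroup is normal, and it is not inside the kernel because the
    alternating group is not central in the symmetric group. *)
Lemma onto_sym_comm :
    (forall N : {group gT}, N <| G -> ~~ (N \subset 'ker f) -> 'ker f \subset N) ->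
  even_part G s \subset [~: even_part G s, G].
Proof.
move=> kerN; have nsKG := even_part_normal odd_morph.
pose K := Group (group_set_even odd_morph).
have nsNG : [~: K, G] <| G.
  by have := commg_normal K G; rewrite (joing_idPr (normal_sub nsKG : K \subset G)).
suff nNB : ~~ ([~: K, G] \subset 'ker f) by apply: onto_sym_normal (kerN _ nsNG nNB).
have [u [v [even_u ntuv]]] := exists_noncentral_even T_ge3.
have /morphimP[x Gx _ def_u] : u \in f @* G by rewrite f_onto inE.
have /morphimP[y Gy _ def_v] : v \in f @* G by rewrite f_onto inE.
apply: contra ntuv => /subsetP/(_ [~ x, y]) Bxy.
rewrite def_u def_v -morphR //; apply/eqP/(mker (Bxy _)); apply: mem_commg => //.
by rewrite inE Gx /s -def_u.
Qed.

End OntoSym.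

(** * Coordinates in wreath products *)

Section WreathCoordinates.

Variables d n : nat.
Implicit Types (b c : 'I_d -> {perm vertex d n}) (a : 'S_d).

Lemma wr_inj b c a a' : wr b a = wr c a' -> a = a' /\ b =1 c.
Proof.
move=> eq_wr_bc.
have E i (w : vertex d n) : a i :: b i w = a' i :: c i w :> seq _.
  have /(congr1 (fun g : {perm vertex d n.+1} => val (g [bseq of i :: w]))) := eq_wr_bc.
  by rewrite /= !wrE /= insub_bseqK.
split; first by apply/permP=> i; case: (E i [bseq]).
by move=> i; apply/permP=> w; apply: val_inj; case: (E i w).
Qed.

Lemma wr1 : wr (fun=> 1 : {perm vertex d n}) 1 = 1.
Proof.
apply/permP=> u; apply: val_inj; rewrite perm1 /= wrE.
by case: u => -[|i w] //= lew; rewrite !perm1 val_insub_bseq.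
Qed.

Lemma wrV b a : (wr b a)^-1 = wr (fun i => (b (a^-1 i))^-1) a^-1.
Proof.
apply/eqP; rewrite eq_invg_mul wrM mulgV -wr1; apply/eqP; apply: eq_wr => i.
by rewrite permK mulgV.
Qed.

Lemma wrJ b c a : wr b 1 ^ wr c a = wr (fun i => b (a^-1 i) ^ c (a^-1 i)) 1.
Proof.
rewrite conjgE wrV !wrM mul1g mulVg; apply: eq_wr => i.
by rewrite perm1 -conjgE.
Qed.

Lemma wr_comm b c : [~ wr b 1, wr c 1] = wr (fun i => [~ b i, c i]) 1.
Proof.
rewrite commgEl wrV wrJ wrM invg1 mulg1; apply: eq_wr => i.
by rewrite !perm1 commgEl.
Qed.

Lemma wr_mul1 b c : wr b 1 * wr c 1 = wr (fun i => b i * c i) 1.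
Proof. by rewrite wrM mulg1; apply: eq_wr => i; rewrite perm1. Qed.

Definition at_child i (x : {perm vertex d n}) : {perm vertex d n.+1} :=
  wr (fun k => if k == i then x else 1) 1.

Lemma at_childJ i x c a : at_child i x ^ wr c a = at_child (a i) (x ^ c i).
Proof.
rewrite wrJ; apply: eq_wr => k; rewrite (canF_eq (permKV _)).
by case: eqP => [->|_]; rewrite ?permK ?conj1g.
Qed.

Lemma wr_base_gen (X : {group {perm vertex d n.+1}}) b :
  (forall i, at_child i (b i) \in X) -> wr b 1 \in X.
Proof.
move=> Xb; suff: wr (fun i => if i \in enum 'I_d then b i else 1) 1 \in X.
  by congr (_ \in X); apply: eq_wr => i; rewrite mem_enum.
elim: (enum _) (enum_uniq 'I_d) => [_|j r IHr /= /andP[r'j /IHr Xr]].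
  by rewrite (eq_wr _ (_ : _ =1 fun=> 1)) ?wr1.
rewrite (eq_wr (b' := fun i => (if i == j then b j else 1) *
   (if i \in r then b i else 1))).
  by rewrite -wr_mul1 groupM // Xb.
move=> i; rewrite inE; case: eqP => [->|_]; last by rewrite mul1g.
by rewrite (negPf r'j) mulg1.
Qed.

(** The action on the first level. The coordinates of an element of the wreath
    product are unique, so it does not matter which ones are picked. *)
Definition top (g : {perm vertex d n.+1}) : 'S_d :=
  odflt 1 [pick a : 'S_d | [exists b : {ffun 'I_d -> {perm vertex d n}}, g == wr b a]].

Lemma top_wr b a : top (wr b a) = a.
Proof.
rewrite /top; case: pickP => [a' /existsP[c /eqP/wr_inj[]] //|/(_ a)/existsP[]].
by exists (finfun b); apply/eqP/eq_wr=> i; rewrite ffunE.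
Qed.

End WreathCoordinates.

Arguments at_child {d n} i x.

Notation top_sgn := (fun g => odd_perm (top g)).

Definition parity d (T : Type) (s : T -> bool) (b : 'I_d -> T) : bool :=
  \big[addb/false]_i s (b i).

(** Coordinates are unique, so the quantifiers only read them off g. *)
Definition even_wreath d n (G : {set {perm vertex d n}}) s : {set {perm vertex d n.+1}} :=
  [set g in wreath G | [exists a : 'S_d, exists b : {ffun 'I_d -> {perm vertex d n}},
                         (g == wr b a) && (parity s b == odd_perm a)]].

Lemma eq_parity d T (s : T -> bool) (b c : 'I_d -> T) : b =1 c -> parity s b = parity s c.
Proof. by move=> eq_bc; apply: eq_bigr => i _; rewrite eq_bc. Qed.

Lemma even_wreathP d n (G : {set {perm vertex d n}}) s b a :
  reflect ((forall i, b i \in G) /\ parity s b = odd_perm a) (wr b a \in even_wreath G s).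
Proof.
apply: (iffP setIdP) => [[/wreathP[c [a' [Gc /wr_inj[_ eq_bc]]]]]|[Gb odd_b]].
  case/existsP=> a1 /existsP[b1 /andP[/eqP/wr_inj[-> eq_bb1] /eqP <-]].
  by split=> [i|]; [rewrite eq_bc | apply: eq_parity].
split; first by apply/wreathP; exists b, a.
apply/existsP; exists a; apply/existsP; exists (finfun b).
rewrite (@eq_wr _ _ _ b) -?odd_b; last by move=> i; rewrite ffunE.
by rewrite eqxx (@eq_parity _ _ _ _ b) ?eqxx // => i; rewrite ffunE.
Qed.

Lemma even_wreath_wr d n (G : {set {perm vertex d n}}) s g :
  g \in even_wreath G s -> exists b a, g = wr b a.
Proof. by case/setIdP=> /wreathP[b [a [_ ->]]] _; exists b, a. Qed.

(** * The even-weight permutation module *)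

Lemma big_addb_const m (x : bool) : \big[addb/false]_(i < m) x = odd m && x.
Proof.
by rewrite big_const_ord; elim: m => //= m ->; case: (odd m); case: x.
Qed.

Section Parity.

Variables (d : nat) (gT : finGroupType) (G : {group gT}) (s : gT -> bool).
Hypothesis sM : {in G &, {morph s : x y / x * y >-> x (+) y}}.
Implicit Types b c : 'I_d -> gT.

Lemma parityM b c : (forall i, b i \in G) -> (forall i, c i \in G) ->
  parity s (fun i => b i * c i) = parity s b (+) parity s c.
Proof.
by move=> Gb Gc; rewrite /parity -big_split; apply: eq_bigr => i _; rewrite sM.
Qed.

Lemma parity_delta (i : 'I_d) x : parity s (fun k => if k == i then x else 1) = s x.
Proof.
rewrite /parity (bigD1 i) //= eqxx big1 ?addbF // => k /negPf->.
exact: (sgn_morph1 sM).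
Qed.

Lemma parity_pair (i j : 'I_d) x : i != j ->
  parity s (fun k => if k \in [set i; j] then x else 1) = false.
Proof.
move=> nij; rewrite /parity (bigD1 i) //= (bigD1 j) 1?eq_sym //= !inE !eqxx orbT.
rewrite big1 ?addbF ?addbb // => k /andP[/negPf nki /negPf nkj].
by rewrite !inE nki nkj; apply: (sgn_morph1 sM).
Qed.

(** The all-one vector of F_2^d has weight d, which is odd. *)
Lemma parity_exists_even b j : odd d -> parity s b = false -> s (b j) ->
  exists k, ~~ s (b k).
Proof.
move=> d_odd b_even s_bj; apply/existsP; rewrite -negb_forall.
apply/negP=> /forallP s_b; move: b_even.
have -> : parity s b = \big[addb/false]_(i < d) true.
  by apply: eq_bigr => i _; apply: s_b.
by rewrite big_addb_const d_odd.
Qed.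

End Parity.

Section EvenSubmodule.

Variables (d n : nat) (G : {group {perm vertex d n}}) (s : {perm vertex d n} -> bool).
Hypotheses (d_odd : odd d).
Hypothesis sM : {in G &, {morph s : x y / x * y >-> x (+) y}}.

(** Irreducibility of the even-weight submodule of F_2^d: modulo the kernel of s
    at each vertex, wr b 1 stands for the vector of the s (b i). A nonzero vector
    b of even weight has a zero coordinate k because d is odd; adding to it its
    image under a transposition (j k) with s (b j) leaves a vector of weight two.
    The vectors of weight two are conjugate and they span. *)
Lemma even_submodule (X : {group {perm vertex d n.+1}}) b j :
    (forall i x, x \in even_part G s -> at_child i x \in X) ->
    (forall a, exists c, (forall i, c i \in G) /\ wr c a \in 'N(X)) ->
    (forall i, b i \in G) -> parity s b = false -> s (b j) -> wr b 1 \in X ->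
  forall c, (forall i, c i \in G) -> parity s c = false -> wr c 1 \in X.
Proof.
move=> XK nX Gb b_even s_bj Xb.
have [k s'bk] := parity_exists_even d_odd b_even s_bj.
have njk : j != k by apply: contraTneq s_bj => ->.
have [e [Ge Xe s_e]] : exists e, [/\ forall i, e i \in G, wr e 1 \in X &
                          forall i, s (e i) = (i == j) || (i == k)].
  have [c [Gc nXc]] := nX (tperm j k).
  pose e i := b (tperm j k i) ^ c (tperm j k i) * (b i)^-1; exists e; split=> [i||i].
  - by rewrite groupM ?groupV ?groupJ.
  - have: wr b 1 ^ wr c (tperm j k) * (wr b 1)^-1 \in X.
      by rewrite groupM ?groupV ?memJ_norm.
    rewrite wrJ wrV invg1 wr_mul1 tpermV; congr (_ \in X); apply: eq_wr => i.
    by rewrite perm1.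
  rewrite /e sM ?groupV ?groupJ // (sgn_morphJ sM) // (sgn_morphV sM) //.
  have [-> | nij] := eqVneq i j; first by rewrite tpermL s_bj (negPf s'bk).
  have [-> | nik] := eqVneq i k; first by rewrite tpermR s_bj (negPf s'bk).
  by rewrite tpermD 1?eq_sym // addbb.
have Xpair j1 k1 : j1 != k1 -> exists f, [/\ forall i, f i \in G, wr f 1 \in X &
                          forall i, s (f i) = (i == j1) || (i == k1)].
  move=> njk1; have [a [aj ak]] := perm_map2 njk njk1.
  have [c [Gc nXc]] := nX a.
  exists (fun i => e (a^-1 i) ^ c (a^-1 i)); split=> [i||i].
  - by rewrite groupJ.
  - by rewrite -wrJ memJ_norm.
  by rewrite (sgn_morphJ sM) // s_e !(canF_eq (permKV _)) aj ak.
move=> c; have [m] := ubnP #|[set i | s (c i)]|.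
(* Each step removes two points from the support of c. *)
elim: m c => // m IHm c lt_c_m Gc c_even.
have [c0 | [j1 s_cj]] := set_0Vmem [set i | s (c i)]; last rewrite inE in s_cj.
  apply: wr_base_gen => i; apply: XK; rewrite inE Gc.
  by move/setP/(_ i): c0; rewrite !inE => ->.
have [k1 /andP[nkj s_ck]] : exists k1, (k1 != j1) && s (c k1).
  apply/existsP; apply: contraFT c_even => /existsPn c'.
  rewrite /parity (bigD1 j1) //= s_cj big1 // => i nij.
  by have:= c' i; rewrite nij => /negPf.
have [f [Gf Xf s_f]] := Xpair _ _ nkj.
rewrite -(groupMr _ Xf) wr_mul1 IHm // => [|i|]; last 2 first.
- by rewrite groupM.
- rewrite (parityM sM) // c_even addFb.
  rewrite /parity (bigD1 k1) //= (bigD1 j1) 1?eq_sym //= !s_f !eqxx orbT /=.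
  by rewrite big1 // => i /andP[/negPf nik /negPf nij]; rewrite s_f nik nij.
rewrite -ltnS (leq_trans _ lt_c_m) // ltnS; apply: proper_card.
apply/properP; split; last first.
  by exists j1; rewrite inE ?s_cj // sM // s_f s_cj eqxx orbT.
apply/subsetP=> i; rewrite !inE sM // s_f.
have [-> _|_] := eqVneq i k1; first by [].
have [-> _|_] := eqVneq i j1; first by rewrite s_cj.
by rewrite addbF.
Qed.

End EvenSubmodule.

(** * Normal subgroups of the even wreath product *)

Section Slices.

Variables (d n : nat) (G : {group {perm vertex d n}}) (N : {group {perm vertex d n.+1}}).

(** When i is in S, these are the values at i of the elements of N that fix the
    first level and are supported on S. For S = [set i] they are the elements
    that N contains below i alone; commutators shrink S down to that case. *)
Definition slice (S : {set 'I_d}) (i : 'I_d) : {set {perm vertex d n}} :=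
  [set x in G | [exists b : {ffun 'I_d -> {perm vertex d n}},
    [&& b \in ffun_on (mem G), b i == x, [forall k, (k \notin S) ==> (b k == 1)]
      & wr b 1 \in N]]].

Lemma sliceP (S : {set 'I_d}) i x :
  reflect (exists b, [/\ forall k, b k \in G, b i = x,
                         forall k, k \notin S -> b k = 1 & wr b 1 \in N])
          (x \in slice S i).
Proof.
apply: (iffP idP) => [/setIdP[Gx /existsP[b]]|[b [Gb <- bS Nb]]].
  case/and4P=> /ffun_onP Gb /eqP bi /forall_inP bS Nb.
  by exists b; split=> // k /bS/eqP.
rewrite inE Gb; apply/existsP; exists (finfun b); rewrite ffunE eqxx.
rewrite (@eq_wr _ _ _ b) ?Nb; last by move=> k; rewrite ffunE.
rewrite andbT; apply/andP; split; first by apply/ffun_onP=> k; rewrite ffunE; apply: Gb.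
by apply/forall_inP=> k /bS; rewrite ffunE => ->.
Qed.

Lemma group_set_slice S i : group_set (slice S i).
Proof.
apply/group_setP; split=> [|x y].
  by apply/sliceP; exists (fun=> 1); split; rewrite ?wr1.
case/sliceP=> b [Gb <- bS Nb] /sliceP[c [Gc <- cS Nc]]; apply/sliceP.
exists (fun k => b k * c k); split=> // [k|k S'k|]; first exact: groupM.
  by rewrite bS ?cS ?mulg1.
by rewrite -wr_mul1 groupM.
Qed.
Canonical slice_group S i := Group (group_set_slice S i).

End Slices.

Section EvenWreath.

Variables (d n : nat) (G : {group {perm vertex d n}}) (s : {perm vertex d n} -> bool).
Variables (W : {group {perm vertex d n.+1}}) (t : {perm vertex d n}).
Hypotheses (d_ge3 : 2 < d) (d_odd : odd d) (W_E : W = even_wreath G s :> {set _}).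
Hypothesis sM : {in G &, {morph s : x y / x * y >-> x (+) y}}.
Hypotheses (Gt : t \in G) (s_t : s t).

Let K := even_part G s.
Let nsKG : K <| G := even_part_normal sM.

Lemma exists_third (i j : 'I_d) : exists k, k != i /\ k != j.
Proof.
have [|k] := @exists_notin _ [:: i; j]; first by rewrite card_ord.
by rewrite !inE negb_or => /andP[]; exists k.
Qed.

Lemma mem_even_wreath b a :
  wr b a \in W <-> (forall i, b i \in G) /\ parity s b = odd_perm a.
Proof. by rewrite W_E; split=> /even_wreathP. Qed.

Lemma even_wreath_coord g : g \in W -> exists b a, g = wr b a.
Proof. by rewrite W_E; apply: even_wreath_wr. Qed.

Lemma mem_base b : (forall i, b i \in G) -> parity s b = false -> wr b 1 \in W.
Proof. by move=> Gb b0; rewrite mem_even_wreath odd_perm1. Qed.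

(** An odd a is compensated by the odd element t at one vertex. *)
Lemma even_wreath_top_onto a : exists c, (forall i, c i \in G) /\ wr c a \in W.
Proof.
pose i0 : 'I_d := Ordinal (ltnW (ltnW d_ge3)).
pose c i := if i == i0 then if odd_perm a then t else 1 else 1.
have Gc i : c i \in G by rewrite /c; do 2?case: ifP.
exists c; split=> //; apply/mem_even_wreath; split=> //; rewrite (parity_delta sM).
by case: ifP; rewrite // (sgn_morph1 sM).
Qed.

Lemma top_morph : {in W &, {morph @top d n : g h / g * h}}.
Proof.
by move=> _ _ /even_wreath_coord[b [a ->]] /even_wreath_coord[c [a' ->]]; rewrite wrM !top_wr.
Qed.
Let ftop := Morphism top_morph.

Lemma top_onto : ftop @* W = [set: 'S_d].
Proof.
apply/setP=> a; rewrite inE; apply/morphimP; have [c [_ Wc]] := even_wreath_top_onto a.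
by exists (wr c a); rewrite //= top_wr.
Qed.

Lemma mem_ker_top g : reflect
  (exists b, [/\ forall i, b i \in G, parity s b = false & g = wr b 1]) (g \in 'ker ftop).
Proof.
apply: (iffP idP) => [kg | [b [Gb b0 ->]]]; last first.
  by apply/kerP; [apply: mem_base | apply: top_wr].
have Wg : g \in W := dom_ker kg; have [b [a def_g]] := even_wreath_coord Wg.
have a1 : a = 1 by rewrite -(top_wr b a) -def_g; apply: (mker kg).
rewrite def_g a1 in Wg *; exists b.
by have [Gb] := (mem_even_wreath _ _).1 Wg; rewrite odd_perm1.
Qed.

Lemma comm_in_normal (N : {group {perm vertex d n.+1}}) u h :
  N <| W -> u \in N -> h \in W -> [~ u, h] \in N.
Proof.
by move=> /andP[_ nNW] Nu Wh; rewrite commgEl groupM ?groupV ?memJ_norm ?(subsetP nNW).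
Qed.

Section NormalSubgroup.

Variable N : {group {perm vertex d n.+1}}.
Hypothesis nsNW : N <| W.

(** An element with the same value y at i and at k, and trivial elsewhere, has
    parity 0 whatever y is, so it is in W. Taking commutators
    with it erases all coordinates but i and k. *)
Lemma slice_comm S i k : k != i ->
  [~: slice G N S i, G] \subset slice G N (S :&: [set i; k]) i.
Proof.
rewrite eq_sym => nik; rewrite gen_subG; apply/subsetP=> _ /imset2P[x y Px Gy ->].
have /sliceP[b [Gb <- bS Nb]] := Px.
pose c m := if m \in [set i; k] then y else 1.
have Gc m : c m \in G by rewrite /c; case: ifP.
apply/sliceP; exists (fun m => [~ b m, c m]); split=> [m||m|].
- by rewrite groupR.
- by rewrite /c !inE eqxx.
- rewrite /c inE; case: ifP; first by rewrite andbT => _ /bS->; rewrite comm1g.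
  by rewrite commg1.
by rewrite -wr_comm comm_in_normal // mem_base // (parity_pair sM).
Qed.

(** Two vertices k and j other than i are enough: {i, k} and {i, j} meet in {i}. *)
Lemma slice_comm2 S i : [~: [~: slice G N S i, G], G] \subset slice G N [set i] i.
Proof.
have [k [nki _]] := exists_third i i; have [j [nji njk]] := exists_third i k.
apply: subset_trans (commSg _ (slice_comm S nki)) _.
apply: subset_trans (slice_comm _ nji) _.
apply/subsetP=> x /sliceP[b [Gb bi bS Nb]]; apply/sliceP; exists b; split=> // m.
rewrite inE => nmi; apply: bS; rewrite !inE (negPf nmi) /=.
by apply/negP=> /andP[/andP[_ /eqP->] /eqP ekj]; rewrite ekj eqxx in njk.
Qed.

Lemma slice1P i x : reflect (x \in G /\ at_child i x \in N) (x \in slice G N [set i] i).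
Proof.
apply: (iffP (sliceP _ _ _ _ _)) => [[b [Gb <- bS Nb]]|[Gx Nx]].
  split=> //; congr (_ \in N): Nb; apply: eq_wr => k.
  by case: eqP => [->//|/eqP nki]; rewrite bS // inE.
exists (fun k => if k == i then x else 1); split=> // [k||k].
- by case: ifP.
- by rewrite eqxx.
by rewrite inE => /negPf->.
Qed.

Lemma at_child_trans (P : {group {perm vertex d n}}) i : P <| G ->
  P \subset slice G N [set i] i -> forall j x, x \in P -> at_child j x \in N.
Proof.
move=> /andP[sPG nPG] sPN j x Px; have [c [Gc Wc]] := even_wreath_top_onto (tperm i j).
have: x ^ (c i)^-1 \in slice G N [set i] i.
  by rewrite (subsetP sPN) // memJ_norm // groupV (subsetP nPG).
case/slice1P=> _ Nx; have: at_child i (x ^ (c i)^-1) ^ wr c (tperm i j) \in N.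
  by rewrite memJ_norm // (subsetP (normal_norm nsNW)).
by rewrite at_childJ tpermL conjgKV.
Qed.

End NormalSubgroup.

(** The element b has the odd value t at i and at a vertex other than i and a i.
    Conjugation takes a copy of t to a i, where b itself is trivial. *)
Lemma moving_commutator c a i : wr c a \in W -> a i != i ->
  exists b e, [/\ wr b 1 \in W, wr e 1 = [~ wr b 1, wr c a], forall k, e k \in G,
                  parity s e = false & s (e (a i))].
Proof.
move=> Wca nai; have [k [nki nka]] := exists_third i (a i).
pose b m := if m \in [set i; k] then t else 1.
have Gb m : b m \in G by rewrite /b; case: ifP.
have Wb : wr b 1 \in W by rewrite mem_base // (parity_pair sM) // eq_sym.
pose e m := (b m)^-1 * b (a^-1 m) ^ c (a^-1 m).
have eE : wr e 1 = [~ wr b 1, wr c a].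
  by rewrite commgEl wrJ wrV invg1 wr_mul1; apply: eq_wr => m; rewrite perm1.
have We : wr e 1 \in W by rewrite eE groupR.
have [Ge] := (mem_even_wreath _ _).1 We; rewrite odd_perm1 => e0.
have [Gc _] := (mem_even_wreath _ _).1 Wca.
exists b, e; split=> //.
rewrite /e permK /b !inE (negPf nai) eq_sym (negPf nka) eqxx invg1 mul1g.
by rewrite /= (sgn_morphJ sM Gt (Gc i)).
Qed.

Lemma ker_top_sub_of_odd_coord (N : {group {perm vertex d n.+1}}) b :
    N <| W -> (forall i x, x \in K -> at_child i x \in N) ->
    (forall i, b i \in G) -> parity s b = false -> wr b 1 \in N ->
  forall i, s (b i) -> 'ker ftop \subset N.
Proof.
move=> nsNW NK Gb b0 Nb i s_bi; apply/subsetP=> _ /mem_ker_top[c [Gc c0 ->]].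
apply: (even_submodule d_odd sM NK _ Gb b0 s_bi Nb) => // a.
have [e [Ge We]] := even_wreath_top_onto a; exists e; split=> //.
exact: (subsetP (normal_norm nsNW)).
Qed.

(* Only the top chief factor of G is central. *)
Hypothesis G_comm : forall N : {group {perm vertex d n}}, N <| G ->
  N = G :> {set _} \/ (N \subset K) && (N \subset [~: N, G]).

Lemma even_comm : K \subset [~: K, G].
Proof.
case: (@G_comm (Group (group_set_even sM)) nsKG) => [/setP/(_ t)|/andP[] //].
by rewrite !inE Gt s_t.
Qed.

(** If g in N takes i to another vertex a i, its commutators with the elements of
    K placed at i are supported on {i, a i} and have arbitrary values of K at i.
    Hence N contains [[K, G], G] = K at i, then at each vertex; modulo these
    subgroups, moving_commutator gives a nonzero vector of even weight. *)
Lemma ker_top_sub_normal (N : {group {perm vertex d n.+1}}) :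
  N <| W -> ~~ (N \subset 'ker ftop) -> 'ker ftop \subset N.
Proof.
move=> nsNW /subsetPn[g Ng nkg]; have Wg := subsetP (normal_sub nsNW) g Ng.
have [c [a def_g]] := even_wreath_coord Wg; rewrite def_g in Ng Wg nkg.
have [i nai] : exists i, a i != i.
  apply/existsP; rewrite -negb_forall; apply: contra nkg => /forallP a1.
  by apply/kerP => //=; rewrite top_wr; apply/permP=> i; rewrite perm1; apply/eqP.
have [Gc _] := (mem_even_wreath _ _).1 Wg.
have sK2 : K \subset slice G N [set i; a i] i.
  apply/subsetP=> x Kx; have [Gx s'x] := setIdP Kx.
  have Wx : at_child i x \in W.
    apply: mem_base => [k|]; first by case: ifP.
    by rewrite (parity_delta sM); apply: negPf.
  rewrite -groupV; apply/sliceP.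
  exists (fun k => (if k == i then x else 1)^-1 * (if k == a i then x ^ c i else 1)).
  split=> [k||k|].
  - by apply: groupM; rewrite ?groupV; case: ifP => _; rewrite ?groupJ ?group1 ?Gc.
  - by rewrite eqxx eq_sym (negPf nai) mulg1.
  - by rewrite !inE negb_or => /andP[/negPf-> /negPf->]; rewrite invg1 mulg1.
  have: [~ at_child i x, wr c a] \in N.
    by rewrite -groupV invg_comm comm_in_normal.
  rewrite commgEl at_childJ /at_child wrV invg1 wr_mul1; congr (_ \in N).
  by apply: eq_wr => k; rewrite perm1.
have sK1 : K \subset slice G N [set i] i.
  apply: subset_trans even_comm _; apply: subset_trans (commSg _ even_comm) _.
  by apply: subset_trans (commSg _ (commSg _ sK2)) (slice_comm2 _ _ _).
have NK := at_child_trans nsNW (P := Group (group_set_even sM)) nsKG sK1.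
have [b [e [Wb eE Ge e0 s_e]]] := moving_commutator Wg nai.
apply: ker_top_sub_of_odd_coord NK Ge e0 _ _ s_e => //.
by rewrite eE -groupV invg_comm comm_in_normal.
Qed.

(** The group P is the projection of N to one vertex. N contains [[P, G], G] at
    each vertex; this is P when P is proper. When P = G it contains K, and t in P
    provides an element of N with an odd coordinate. *)
Lemma normal_in_ker_top (N : {group {perm vertex d n.+1}}) :
    N <| W -> N \subset 'ker ftop ->
  'ker ftop \subset N \/
  exists P : {group {perm vertex d n}},
    [/\ P <| G, P \subset K, P \subset [~: P, G] &
        forall b, (wr b 1 \in N) <-> (forall i, b i \in P)].
Proof.
move=> nsNW sNB; pose i0 : 'I_d := Ordinal (ltnW (ltnW d_ge3)).
have nNW := subsetP (normal_norm nsNW).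
pose P := slice_group G N setT i0.
have Pb b i : wr b 1 \in N -> exists2 g, g \in G & b i ^ g \in P.
  move=> Nb; have [Gb _] := (mem_even_wreath _ _).1 (subsetP (normal_sub nsNW) _ Nb).
  have [c [Gc Wc]] := even_wreath_top_onto (tperm i i0); exists (c i) => //.
  apply/sliceP; exists (fun k => b ((tperm i i0)^-1 k) ^ c ((tperm i i0)^-1 k)).
  split=> [k||k|]; [by rewrite groupJ ?Gb ?Gc | by rewrite tpermV tpermR | by rewrite inE |].
  by rewrite -wrJ memJ_norm // nNW.
have sPG : P \subset G by apply/subsetP=> x /setIdP[].
have nsPG : P <| G.
  rewrite /normal sPG; apply/subsetP=> y Gy; rewrite inE.
  apply/subsetP=> _ /imsetP[_ /sliceP[b [Gb <- _ Nb]] ->].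
  have [k [nki _]] := exists_third i0 i0.
  pose c m := if m \in [set i0; k] then y else 1.
  have Wc : wr c 1 \in W.
    by rewrite mem_base ?(parity_pair sM) 1?eq_sym // => m; rewrite /c; case: ifP.
  have: wr b 1 ^ wr c 1 \in N by rewrite memJ_norm // nNW.
  rewrite wrJ invg1 => Nbc; apply/sliceP; eexists; split; last exact: Nbc.
  - by move=> m; rewrite groupJ ?Gb // /c; case: ifP.
  - by rewrite /= !perm1 /c !inE eqxx.
  by move=> m; rewrite inE.
have {}Pb b i : wr b 1 \in N -> b i \in P.
  by case/(Pb b i)=> g Gg; rewrite memJ_norm // (subsetP (normal_norm nsPG)).
have sP2 := slice_comm2 nsNW setT i0.
have [PG | /andP[sPK sPcomm]] := G_comm nsPG.
  left; have sKP : K \subset P by rewrite PG normal_sub.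
  have sK1 : K \subset slice G N [set i0] i0.
    apply: subset_trans even_comm (subset_trans (commSg _ even_comm) _).
    by apply: subset_trans (commSg _ (commSg _ _)) sP2.
  have NK := at_child_trans nsNW (P := Group (group_set_even sM)) nsKG sK1.
  have /sliceP[b [Gb bi _ Nb]] : t \in P by rewrite PG.
  have [_ b0] := (mem_even_wreath _ _).1 (subsetP (normal_sub nsNW) _ Nb).
  by apply: (ker_top_sub_of_odd_coord nsNW NK Gb _ Nb (i := i0)); rewrite ?b0 ?odd_perm1 ?bi.
right; exists P; split=> // b; split=> [Nb i|Pbi]; first exact: Pb.
apply: wr_base_gen => i.
have NP := at_child_trans nsNW nsPG (i := i0); apply: NP (Pbi i).
by apply: subset_trans sPcomm (subset_trans (commSg _ sPcomm) sP2).
Qed.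

Let s' : {perm vertex d n.+1} -> bool := top_sgn.

(** If N acts nontrivially on the first level, the claim comes from the symmetric
    group. If N = P^d, then [N, W] contains [P, G] at each vertex. If N is the
    kernel of the action on the first level, then [N, W] has an element with an
    odd coordinate, which excludes that it be P^d with P inside K. *)
Lemma even_wreath_normal_comm (N : {group {perm vertex d n.+1}}) : N <| W ->
  N = W :> {set _} \/ (N \subset even_part W s') && (N \subset [~: N, W]).
Proof.
move=> nsNW; have sNW := normal_sub nsNW.
have d3 : 2 < #|'I_d| by rewrite card_ord.
have dO : odd #|'I_d| by rewrite card_ord.
have normM : [~: N, W] <| W.
  by have := commg_normal N W; rewrite (joing_idPr sNW).
have sMN : [~: N, W] \subset N by rewrite commg_subl; case/andP: nsNW.
have [sNB | nNB] := boolP (N \subset 'ker ftop); last first.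
  have sKN := onto_sym_normal d3 dO top_onto nsNW nNB (ker_top_sub_normal nsNW nNB).
  have [-> | NK] := normal_above_even (odd_morph ftop) nsNW sKN; [by left | right].
  rewrite NK subxx; apply: (onto_sym_comm d3 dO top_onto) => M nsM.
  exact: ker_top_sub_normal.
right; apply/andP; split.
  apply/subsetP=> x Nx; rewrite inE (subsetP sNW) //.
  by rewrite /s' (mker (subsetP sNB x Nx) : top x = 1) odd_perm1.
have [sBN | [P [nsPG sPK sPcomm NP]]] := normal_in_ker_top nsNW sNB.
  apply: (subset_trans sNB).
  have [//|[P [nsPG sPK sPcomm MP]]] := normal_in_ker_top normM (subset_trans sMN sNB).
  have i0 : 'I_d := Ordinal (ltnW (ltnW d_ge3)).
  have [j [nj _]] := exists_third i0 i0.
  have [c [Gc Wc]] := even_wreath_top_onto (tperm i0 j).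
  have [|b [e [Wb eE Ge e0 s_e]]] := @moving_commutator _ _ i0 Wc; first by rewrite tpermL.
  have Me : wr e 1 \in [~: N, W].
    rewrite eE mem_commg // (subsetP sBN) //; apply/mem_ker_top; exists b.
    by have [Gb] := (mem_even_wreath _ _).1 Wb; rewrite odd_perm1.
  have /(_ (tperm i0 j i0)) := (MP e).1 Me; move/(subsetP sPK).
  by rewrite inE s_e andbF.
apply/subsetP=> x Nx; have Wx := subsetP sNW x Nx.
have /mem_ker_top[b [Gb b0 def_x]] := subsetP sNB x Nx; rewrite def_x in Nx *.
apply: wr_base_gen => i.
have sPM : P \subset slice G [~: N, W]%G [set i] i.
  apply: subset_trans sPcomm _; rewrite gen_subG.
  apply/subsetP=> _ /imset2P[x1 y Px Gy ->]; have Gx := subsetP (normal_sub nsPG) _ Px.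
  apply/slice1P; split; first exact: groupR.
  have [k [nki _]] := exists_third i i.
  pose c m := if m \in [set i; k] then y else 1.
  have -> : at_child i [~ x1, y] = [~ at_child i x1, wr c 1].
    rewrite wr_comm; apply: eq_wr => m; rewrite /c !inE.
    by case: eqP; rewrite ?comm1g.
  apply: mem_commg; first by apply/NP=> m; case: ifP.
  by rewrite mem_base ?(parity_pair sM) 1?eq_sym // => m; rewrite /c; case: ifP.
have /slice1P[] // := subsetP sPM (b i) ((NP b).1 Nx i).
Qed.

Lemma even_part_sub_normal (N : {group {perm vertex d n.+1}}) x :
  N <| W -> x \in N -> top x != 1 -> even_part W s' \subset N.
Proof.
move=> nsNW Nx ntx; have nNB : ~~ (N \subset 'ker ftop).
  by apply: contra ntx => /subsetP/(_ x Nx)/mker/eqP.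
apply: (onto_sym_normal _ _ top_onto nsNW nNB (ker_top_sub_normal nsNW nNB));
  by rewrite card_ord.
Qed.

Hypothesis G_chain : forall N M : {group {perm vertex d n}}, N <| G -> M <| G ->
  (N \subset M) || (M \subset N).

Lemma even_wreath_normals_chain (N M : {group {perm vertex d n.+1}}) : N <| W -> M <| W ->
  (N \subset M) || (M \subset N).
Proof.
have d3 : 2 < #|'I_d| by rewrite card_ord.
have dO : odd #|'I_d| by rewrite card_ord.
move=> nsN nsM.
have above (X : {group {perm vertex d n.+1}}) : X <| W -> ~~ (X \subset 'ker ftop) ->
    even_part W s' \subset X /\ (X = W :> {set _} \/ X = even_part W s' :> {set _}).
  move=> nsX nXB.
  have sKX := onto_sym_normal d3 dO top_onto nsX nXB (ker_top_sub_normal nsX nXB).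
  by split=> //; apply: (normal_above_even (odd_morph ftop) nsX sKX).
have [sNB | nNB] := boolP (N \subset 'ker ftop).
  have [sMB | nMB] := boolP (M \subset 'ker ftop); last first.
    by rewrite (subset_trans sNB (ker_top_sub_normal nsM nMB)).
  have [sBN | [P [nsP _ _ NP]]] := normal_in_ker_top nsN sNB.
    by rewrite (subset_trans sMB sBN) orbT.
  have [sBM | [Q [nsQ _ _ MQ]]] := normal_in_ker_top nsM sMB.
    by rewrite (subset_trans sNB sBM).
  have [sPQ | sQP] := orP (G_chain nsP nsQ); apply/orP; [left | right].
    apply/subsetP=> x Nx; have /mem_ker_top[b [_ _ def_x]] := subsetP sNB x Nx.
    rewrite def_x in Nx *; apply/MQ => i; apply: (subsetP sPQ); exact: (NP b).1.
  apply/subsetP=> x Mx; have /mem_ker_top[b [_ _ def_x]] := subsetP sMB x Mx.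
  rewrite def_x in Mx *; apply/NP => i; apply: (subsetP sQP); exact: (MQ b).1.
have [sMB | nMB] := boolP (M \subset 'ker ftop).
  by rewrite (subset_trans sMB (ker_top_sub_normal nsN nNB)) orbT.
have [sKN [->|->]] := above N nsN nNB.
  by rewrite (normal_sub nsM) orbT.
by have [-> _] := above M nsM nMB.
Qed.

End EvenWreath.

(** * A transposition and a rotation generate the symmetric group *)

Section Rotation.

Variable d : nat.
Hypothesis d_ge3 : 2 < d.

Definition rot_perm : 'S_d := perm (@ordS_inj d).

Lemma rot_permE (i : 'I_d) : rot_perm i = i.+1 %% d :> nat.
Proof. by rewrite permE. Qed.

Lemma rot_permX k (i : 'I_d) : (rot_perm ^+ k) i = (i + k) %% d :> nat.
Proof.
elim: k => [|k IHk]; first by rewrite expg0 perm1 addn0 modn_small.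
by rewrite expgSr permM rot_permE IHk -addn1 modnDml addn1 addnS.
Qed.

Lemma rot_perm_order : rot_perm ^+ d = 1.
Proof.
by apply/permP=> i; apply: val_inj; rewrite /= rot_permX perm1 modnDr modn_small.
Qed.

Lemma odd_rot_perm : odd d -> odd_perm rot_perm = false.
Proof.
move=> d_odd; have: odd_perm (rot_perm ^+ d) = false by rewrite rot_perm_order odd_perm1.
have oddX k : odd_perm (rot_perm ^+ k) = odd k && odd_perm rot_perm.
  elim: k => [|k IHk]; first by rewrite expg0 odd_perm1.
  by rewrite expgS odd_permM IHk /=; case: (odd_perm _); case: (odd k).
by rewrite oddX d_odd.
Qed.

Definition pt0 : 'I_d := Ordinal (ltnW (ltnW d_ge3)).
Definition pt1 : 'I_d := Ordinal (ltnW d_ge3).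
Definition pt2 : 'I_d := Ordinal d_ge3.

Lemma rot_pt0 : rot_perm pt0 = pt1.
Proof. by apply: val_inj; rewrite /= rot_permE modn_small // ltnW. Qed.

Lemma rot_pt1 : rot_perm pt1 = pt2.
Proof. by apply: val_inj; rewrite /= rot_permE modn_small. Qed.

Lemma rot_permX_neq1 : rot_perm ^+ (2 * d.-1) != 1.
Proof.
apply/eqP=> /permP/(_ pt0)/(congr1 val) /=.
rewrite rot_permX perm1 /= add0n (_ : (2 * d.-1 = d + (d - 2))%N); last by lia.
by rewrite modnDl modn_small; lia.
Qed.

(** Conjugating (0 1) by the powers of the rotation gives the (k k+1), from which
    the (0 k) are obtained one after the other. *)
Lemma gen_tperm_rot : <<[set tperm pt0 pt1; rot_perm]>> = [set: 'S_d].
Proof.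
pose X := <<[set tperm pt0 pt1; rot_perm]>>%G.
have Xr : rot_perm \in X by rewrite mem_gen // !inE eqxx orbT.
have Xt : tperm pt0 pt1 \in X by rewrite mem_gen // !inE eqxx.
suff : [set tperm pt0 j | j : 'I_d] \subset X.
  by rewrite -gen_subG gen_tperm subTset => /eqP.
suff Xj k (j : 'I_d) : j = k :> nat -> tperm pt0 j \in X.
  by apply/subsetP=> _ /imsetP[j _ ->]; apply: Xj (erefl _).
elim: k j => [|k IHk] j def_j.
  by rewrite (_ : j = pt0) ?tperm1 //; apply: val_inj.
have lt_kd : k < d by apply: ltnW; rewrite -def_j.
pose i : 'I_d := Ordinal lt_kd.
have [k0 | k_gt0] := posnP k.
  by rewrite (_ : j = pt1) //; apply: val_inj; rewrite /= def_j k0.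
have n0i : pt0 != i by rewrite -val_eqE /= eq_sym -lt0n.
have nij : i != j by rewrite -val_eqE /= def_j neq_ltn ltnSn.
have n0j : pt0 != j by rewrite -val_eqE /= def_j.
have -> : tperm pt0 j = tperm pt0 i ^ tperm i j.
  by rewrite tpermJ tpermL tpermD // eq_sym.
rewrite groupJ ?IHk //; have: tperm pt0 pt1 ^ (rot_perm ^+ k) \in X.
  by rewrite groupJ ?groupX.
rewrite tpermJ; congr (tperm _ _ \in X); apply: val_inj; rewrite /= rot_permX /=.
  by rewrite modn_small.
by rewrite add1n -def_j modn_small.
Qed.

(** It fixes pt0 and acts on the other points as a cycle of length d - 1. *)
Definition long_cycle : 'S_d := rot_perm * tperm pt0 pt1.

Lemma long_cycle0 k : (long_cycle ^+ k) pt0 = pt0.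
Proof.
by elim: k => [|k IHk]; rewrite ?perm1 // expgSr permM IHk permM rot_pt0 tpermR.
Qed.

Lemma long_cycle1 k : k < d.-1 -> (long_cycle ^+ k) pt1 = k.+1 :> nat.
Proof.
elim: k => [|k IHk] lt_kd; first by rewrite expg0 perm1.
rewrite expgSr permM; set i := (long_cycle ^+ k) pt1.
have def_i : i = k.+1 :> nat by apply: IHk; apply: ltnW.
have def_ri : rot_perm i = k.+2 :> nat by rewrite rot_permE def_i modn_small; lia.
by rewrite permM tpermD // -val_eqE /= def_ri.
Qed.

Lemma long_cycle_order : long_cycle ^+ d.-1 = 1.
Proof.
have fix1 : (long_cycle ^+ d.-1) pt1 = pt1.
  have -> : d.-1 = d.-2.+1 by lia.
  rewrite expgSr permM; set i := (long_cycle ^+ d.-2) pt1.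
  have def_i : i = d.-1 :> nat by rewrite /i long_cycle1; lia.
  have -> : i = rot_perm^-1 pt0.
    apply: (canRL (permK _)); apply: val_inj; rewrite /= rot_permE def_i.
    by rewrite prednK ?modnn //; lia.
  by rewrite permM permKV tpermL.
apply/permP=> i; rewrite perm1.
have [-> | ni0] := eqVneq i pt0; first exact: long_cycle0.
have i_gt0 : 0 < i by rewrite lt0n -(inj_eq val_inj) in ni0 *.
have -> : i = (long_cycle ^+ i.-1) pt1.
  by apply: val_inj; rewrite /= long_cycle1 ?prednK // -ltnS !prednK //; lia.
by rewrite -permM -expgD addnC expgD permM fix1.
Qed.

End Rotation.

(** * Two generators of the even wreath product *)

Section Generation.

Variables (d n : nat) (G : {group {perm vertex d n}}) (s : {perm vertex d n} -> bool).
Variables (W : {group {perm vertex d n.+1}}) (w y : {perm vertex d n}).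
Hypotheses (d_ge3 : 2 < d) (d_odd : odd d) (W_E : W = even_wreath G s :> {set _}).
Hypothesis sM : {in G &, {morph s : x y / x * y >-> x (+) y}}.
Hypotheses (gen_wy : <<[set w; y]>> = G) (w2 : w * w = 1) (s_w : s w) (s_y : ~~ s y).
Hypothesis above_y : forall N : {group {perm vertex d n}}, N <| G ->
  y ^+ (2 * d.-1) \in N -> even_part G s \subset N.

Local Notation p0 := (pt0 d_ge3).
Local Notation p1 := (pt1 d_ge3).
Local Notation p2 := (pt2 d_ge3).

Let Gw : w \in G.
Proof. by rewrite -gen_wy mem_gen // !inE eqxx. Qed.

Let Gy : y \in G.
Proof. by rewrite -gen_wy mem_gen // !inE eqxx orbT. Qed.

(** The value w sits at a vertex that the transposition fixes: the element
    is thus an involution when w is one. *)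
Definition flip_gen : {perm vertex d n.+1} :=
  wr (fun k => if k == p2 then w else 1) (tperm p0 p1).

Definition rot_gen : {perm vertex d n.+1} :=
  wr (fun k => if k == p0 then y else 1) (rot_perm d).

Lemma flip_gen_mem : flip_gen \in W.
Proof.
apply/(mem_even_wreath W_E); split; first by move=> k; case: ifP.
by rewrite (parity_delta sM) s_w odd_tperm.
Qed.

Lemma rot_gen_mem : rot_gen \in W.
Proof.
apply/(mem_even_wreath W_E); split; first by move=> k; case: ifP.
by rewrite (parity_delta sM) odd_rot_perm ?(negPf s_y).
Qed.

Lemma flip_gen2 : flip_gen * flip_gen = 1.
Proof.
rewrite wrM tperm2 -wr1; apply: eq_wr => k.
rewrite -[p2 in tperm _ _ k == p2](_ : tperm p0 p1 p2 = p2).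
  by rewrite (inj_eq perm_inj); case: ifP; rewrite ?mulg1.
by rewrite tpermD.
Qed.

(** The product carries y at its fixed vertex pt0, and w at the single vertex pt1
    of its long cycle; so within one turn, w is met exactly once from pt1. *)
Lemma flip_rot_expg k : exists r, [/\ (rot_gen * flip_gen) ^+ k = wr r (long_cycle d_ge3 ^+ k),
  r p0 = y ^+ k, forall i, i != p0 -> r i \in <[w]> & 0 < k < d -> r p1 = w].
Proof.
elim: k => [|k [r [rE r0 rw r1]]].
  by exists (fun=> 1); split; rewrite ?expg0 ?wr1.
exists (fun i => let j := (long_cycle d_ge3 ^+ k) i in
  r i * ((if j == p0 then y else 1) * (if rot_perm d j == p2 then w else 1))).
split=> [||i ni0|].
- by rewrite expgSr rE wrM wrM expgSr.
- by rewrite /= long_cycle0 eqxx rot_pt0 mulg1 r0 expgSr.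
- rewrite /= -{1}(long_cycle0 d_ge3 k) (inj_eq perm_inj) (negPf ni0) mul1g.
  by rewrite groupM ?rw //; case: ifP; rewrite ?group1 ?cycle_id.
move=> /andP[_ lt_kd]; rewrite /=; set j := (long_cycle d_ge3 ^+ k) p1.
have def_j : j = k.+1 :> nat by rewrite /j long_cycle1; lia.
have -> : (j == p0) = false by apply/eqP=> /(congr1 val); rewrite /= def_j.
rewrite mul1g; have [k0 | k_gt0] := posnP k.
  have -> : j = p1 by apply: val_inj; rewrite /= def_j k0.
  rewrite rot_pt1 eqxx.
  have /eqP : wr r (long_cycle d_ge3 ^+ k) = wr (fun=> 1) 1 by rewrite -rE k0 wr1.
  by move/eqP/wr_inj=> [_ ->]; rewrite mul1g.
rewrite r1 ?k_gt0 1?ltnW //; case: eqP => [/(congr1 val)|_]; last by rewrite mulg1.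
rewrite /= rot_permE def_j; have [lt_k2 | le_dk] := ltnP k.+2 d.
  by rewrite modn_small // => -[k0]; rewrite k0 in k_gt0.
by rewrite (_ : k.+2 = d) ?modnn //; apply/eqP; rewrite eqn_leq lt_kd.
Qed.

(** One turn of the product q leaves powers of w on the long cycle; two turns kill
    them, as w is an involution, and leave y ^+ (2 * d.-1) at pt0. The values that
    H contains at pt0 alone are normalized by G, because H has elements fixing
    pt0 that act below it as y and as a conjugate of w; hence they contain the
    kernel of s. One turn of q has an odd coordinate, so even_submodule applies. *)
Lemma even_wreath_gen : <<[set flip_gen; rot_gen]>> = W.
Proof.
apply/eqP; rewrite eqEsubset gen_subG; apply/andP; split.
  by apply/subsetP=> g /set2P[] ->; rewrite ?flip_gen_mem ?rot_gen_mem.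
pose H := <<[set flip_gen; rot_gen]>>%G.
have Hh : flip_gen \in H by rewrite mem_gen // !inE eqxx.
have Hg : rot_gen \in H by rewrite mem_gen // !inE eqxx orbT.
have sHW : H \subset W.
  by rewrite gen_subG; apply/subsetP=> g /set2P[] ->; rewrite ?flip_gen_mem ?rot_gen_mem.
have H_lift a : exists c, (forall i, c i \in G) /\ wr c a \in H.
  pose ftop := Morphism (top_morph W_E).
  have sXH : [set tperm p0 p1; rot_perm d] \subset ftop @* H.
    apply/subsetP=> _ /set2P[] ->; apply/morphimP.
      by exists flip_gen; rewrite ?flip_gen_mem //= top_wr.
    by exists rot_gen; rewrite ?rot_gen_mem //= top_wr.
  have: a \in ftop @* H.
    by move: sXH; rewrite -gen_subG gen_tperm_rot => /subsetP->; rewrite ?inE.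
  case/morphimP=> g Wg Hg' ->; have [b [a' def_g]] := even_wreath_coord W_E Wg.
  rewrite def_g in Wg Hg' *; rewrite /= top_wr; exists b; split=> //.
  by have [] := (mem_even_wreath W_E _ _).1 Wg.
pose q := rot_gen * flip_gen; have Hq : q \in H by rewrite groupM.
have d1_bounds : 0 < d.-1 < d by clear -d_ge3; lia.
have [r [rE r0 rw /(_ d1_bounds) r1]] := flip_rot_expg d.-1; rewrite long_cycle_order in rE.
have q2E : q ^+ (2 * d.-1) = at_child p0 (y ^+ (2 * d.-1)).
  rewrite mulnC expgM rE expgS expg1 wr_mul1; apply: eq_wr => i.
  have [->|ni0] := eqVneq i p0; first by rewrite r0 -expgD addnn muln2.
  by have /cycleP[k ->] := rw i ni0; rewrite -expgMn // w2 expg1n.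
pose R := slice_group G H [set p0] p0.
have RP x : reflect (x \in G /\ at_child p0 x \in H) (x \in R) := slice1P _ _ _ _.
have nRy : y \in 'N(R).
  rewrite inE; apply/subsetP=> _ /imsetP[x /RP[Gx Hx] ->]; apply/RP; rewrite groupJ //.
  split=> //; have: at_child p0 x ^ q \in H by rewrite groupJ.
  by rewrite /q wrM at_childJ permM rot_pt0 tpermR /= mulg1.
have nRw : w \in 'N(R).
  suff: w ^ y^-1 \in 'N(R) by rewrite groupJr ?groupV.
  rewrite inE; apply/subsetP=> _ /imsetP[x /RP[Gx Hx] ->]; apply/RP.
  rewrite !groupJ ?groupV //; split=> //.
  (* The path from 0 to 2 under the rotation, the flip at 2, and the way back. *)
  have E1 u : at_child p0 u ^ rot_gen = at_child p1 (u ^ y).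
    by rewrite at_childJ rot_pt0.
  have E2 u : at_child p1 u ^ rot_gen = at_child p2 u.
    by rewrite at_childJ rot_pt1 conjg1.
  have E3 u : at_child p2 u ^ flip_gen = at_child p2 (u ^ w).
    by rewrite at_childJ tpermD.
  have Hconj u v : v \in H -> (u ^ v \in H) = (u \in H) by apply: groupJr.
  have -> : x ^ (w ^ y^-1) = ((x ^ y) ^ w) ^ (y^-1).
    by rewrite -!conjgM; congr (x ^ _); rewrite conjgE invgK mulgA.
  rewrite -(Hconj _ _ Hg) E1 conjgKV -(Hconj _ _ Hg) E2 -E3 (Hconj _ _ Hh).
  by rewrite -E2 (Hconj _ _ Hg) -E1 (Hconj _ _ Hg).
have nsRG : R <| G.
  rewrite /normal -{2}gen_wy gen_subG; apply/andP; split.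
    by apply/subsetP=> x /RP[].
  by apply/subsetP=> x /set2P[] ->.
have sKR : even_part G s \subset R.
  by apply: above_y => //; apply/RP; rewrite groupX // -q2E groupX.
have HK i x : x \in even_part G s -> at_child i x \in H.
  move=> Kx; have [c [Gc Hc]] := H_lift (tperm p0 i).
  have: x ^ (c p0)^-1 \in R.
    rewrite (subsetP sKR) // memJ_norm // groupV.
    by rewrite (subsetP (normal_norm (even_part_normal sM))).
  case/RP=> _ Hx; have: at_child p0 (x ^ (c p0)^-1) ^ wr c (tperm p0 i) \in H.
    by rewrite groupJ.
  by rewrite at_childJ tpermL conjgKV.
have Hr : wr r 1 \in H by rewrite -rE groupX.
have [Gr] := (mem_even_wreath W_E _ _).1 (subsetP sHW _ Hr); rewrite odd_perm1 => r_even.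
have s_r1 : s (r p1) by rewrite r1.
have nH a : exists c, (forall i, c i \in G) /\ wr c a \in 'N(H).
  have [c [Gc Hc]] := H_lift a; exists c; split=> //.
  exact: (subsetP (normG H)).
have H_base := even_submodule d_odd sM HK nH Gr r_even s_r1 Hr.
apply/subsetP=> g Wg; have [b [a def_g]] := even_wreath_coord W_E Wg.
have [c [Gc Hc]] := H_lift a; rewrite -(groupMr _ (groupVr Hc)).
have: g * (wr c a)^-1 \in W by rewrite groupM ?groupV // (subsetP sHW).
rewrite def_g wrV wrM mulgV => /(mem_even_wreath W_E)[Ge].
by rewrite odd_perm1 => e0; apply: H_base.
Qed.

End Generation.

(** * The sign of an automorphism on the second level *)

(** A product of transpositions equal to p is mapped by f to one equal to q. *)
Lemma odd_perm_emb (T U : finType) (f : T -> U) (p : {perm T}) (q : {perm U}) :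
    injective f -> (forall x, q (f x) = f (p x)) ->
    (forall u, u \notin codom f -> q u = u) ->
  odd_perm q = odd_perm p.
Proof.
move=> f_inj qf q_out; have [ts def_p dts] := prod_tpermP p.
have -> : q = \prod_(t <- [seq (f t.1, f t.2) | t <- ts]) tperm t.1 t.2.
  apply/permP=> u; rewrite big_map; have [/codomP[x ->] | f'u] := boolP (u \in codom f).
    rewrite qf def_p; elim: (ts) x => [|t r IHr] x; first by rewrite !big_nil !perm1.
    by rewrite !big_cons !permM /= -inj_tperm // -IHr.
  rewrite q_out //; elim: (ts) => [|t r IHr]; first by rewrite big_nil perm1.
  by rewrite big_cons permM /= tpermD //; apply: contraNneq f'u => <-; apply: codom_f.
rewrite def_p !odd_perm_prod ?size_map // all_map; apply: sub_all dts => t.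
by rewrite /dpair /= (inj_eq f_inj).
Qed.

Section FiberwisePerm.

Variables I J : finType.

Definition fiber_fun (c : I -> {perm J}) (u : I * J) := (u.1, c u.1 u.2).

Lemma fiber_fun_inj c : injective (fiber_fun c).
Proof. by move=> [i j] [k l] [<- /perm_inj->]. Qed.

Definition fiber_perm c := perm (@fiber_fun_inj c).

Lemma odd_fiber_perm c : odd_perm (fiber_perm c) = \big[addb/false]_i odd_perm (c i).
Proof.
pose c_ (r : seq I) i := if i \in r then c i else 1.
have -> : fiber_perm c = fiber_perm (c_ (index_enum I)).
  by apply/permP=> u; rewrite !permE /fiber_fun /c_ mem_index_enum.
elim: (index_enum I) (index_enum_uniq I) => [_|i r IHr /= /andP[r'i /IHr odd_r]].
  rewrite big_nil -(@odd_perm1 (I * J)%type); congr odd_perm.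
  by apply/permP=> -[i j]; rewrite permE perm1 /fiber_fun /c_ /= perm1.
rewrite big_cons -odd_r.
have -> : fiber_perm (c_ (i :: r)) = fiber_perm (c_ [:: i]) * fiber_perm (c_ r).
  apply/permP=> -[k j]; rewrite permM !permE /fiber_fun /= /c_ !inE.
  by case: eqP => [->|_]; rewrite ?(negPf r'i) perm1.
rewrite odd_permM; congr (_ (+) _).
apply: (@odd_perm_emb _ _ (fun j => (i, j))) => [j k [] //|j|[k j] f'kj].
  by rewrite permE /fiber_fun /= /c_ inE eqxx.
rewrite permE /fiber_fun /= /c_ inE; case: eqP => [eki|]; last by rewrite perm1.
by case/codomP: f'kj; exists j; rewrite eki.
Qed.

End FiberwisePerm.

Section SignLevel2.

Variables d n : nat.

Lemma autT_wr (g : {perm vertex d n.+1}) : g \in autT d n.+1 ->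
  exists b : 'I_d -> {perm vertex d n}, (forall i, b i \in autT d n) /\ g = wr b (top g).
Proof.
rewrite -wreath_autT => /wreathP[b [a [Ab ->]]]; exists b; split=> //.
by rewrite top_wr.
Qed.

Lemma autT_level1 (g : {perm vertex d n.+1}) i : g \in autT d n.+1 ->
  g (insub_bseq n.+1 [:: i]) = [:: top g i] :> seq 'I_d.
Proof.
case/autT_wr=> b [Ab {1}->]; rewrite wrE /= val_insub_bseq //=.
rewrite (_ : insub_bseq n [::] = [bseq]); last by apply: val_inj; rewrite /= val_insub_bseq.
by have /autTP[-> _] := Ab i.
Qed.

End SignLevel2.

(** On the leaves (i, j) the automorphism is (i, j) |-> (i, top (b i) j) followed
    by (i, j) |-> (a i, j). The latter is d copies of a, and d is odd. *)
Lemma sgn_at2_wr d n (b : 'I_d -> {perm vertex d n.+1}) (a : 'S_d) :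
    odd d -> (forall i, b i \in autT d n.+1) ->
  sgn_at 2 (wr b a) = odd_perm a (+) parity top_sgn b.
Proof.
move=> d_odd Ab; have Ag : wr b a \in autT d n.+2.
  by rewrite -wreath_autT; apply/wreathP; exists b, a.
rewrite /sgn_at /sgn; set L := [set u | _]; set g := res 2 _.
have A2g : g \in autT d 2 by apply: res_autT.
have nLg : g \in 'N(L | 'P).
  by apply/astabsP=> u; rewrite !inE /= /aperm size_autT.
pose leaf (u : 'I_d * 'I_d) : vertex d 2 := [bseq of [:: u.1; u.2]].
have leaf_inj : injective leaf by move=> [i j] [k l] /(congr1 val) [-> ->].
pose swap (u : 'I_d * 'I_d) := (u.2, u.1).
have swap_inj : injective swap by move=> [i j] [k l] [-> ->].
pose top_perm :=
  perm (inj_comp swap_inj (inj_comp (@fiber_fun_inj _ _ (fun _ : 'I_d => a)) swap_inj)).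
have odd_top : odd_perm top_perm = odd_perm a.
  transitivity (odd_perm (fiber_perm (fun _ : 'I_d => a))).
    apply: (odd_perm_emb swap_inj) => [[i j]|[i j]]; first by rewrite !permE.
    by case/codomP; exists (j, i).
  by rewrite odd_fiber_perm big_addb_const d_odd.
have -> : parity top_sgn b = odd_perm (fiber_perm (fun i => top (b i))).
  by rewrite odd_fiber_perm.
rewrite -odd_top addbC -odd_permM.
apply: (odd_perm_emb leaf_inj) => [[i j]|u f'u].
  have Lij : leaf (i, j) \in L by rewrite inE.
  rewrite (restr_permE nLg Lij); apply: val_inj; rewrite /= resE // wrE /= val_insub_bseq //=.
  by rewrite autT_level1 // permM !permE.
apply: out_perm (restr_perm_on _ _) _; rewrite inE; apply: contra f'u => /eqP.
case: u => -[|i [|j []]] //= le_u _; apply/codomP; exists (i, j).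
exact: val_inj.
Qed.

Lemma E_sub_autT d n : E d n \subset autT d n.
Proof.
case: n => [|[|n]] //; apply: subset_trans (subsetIr _ _) _.
by apply/subsetP=> g /setIdP[].
Qed.

Lemma E_even_wreath d n : odd d ->
  E d n.+2 = even_wreath (E d n.+1) top_sgn.
Proof.
move=> d_odd; apply/setP=> g; apply/setIP/idP=> [[/wreathP[b [a [Eb ->]]]]|Wg].
  case/setIdP=> _; rewrite sgn_at2_wr // => [sgn_g|i]; last exact: (subsetP (E_sub_autT _ _)).
  apply/even_wreathP; split=> //.
  by move: sgn_g; case: (odd_perm a); case: (parity _ _).
have [b [a def_g]] := even_wreath_wr Wg; rewrite def_g in Wg *.
have /even_wreathP[Eb even_b] := Wg.
have Ab i : b i \in autT d n.+1 by apply: (subsetP (E_sub_autT _ _)).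
split; first by apply/wreathP; exists b, a.
rewrite inE sgn_at2_wr // even_b addbb andbT -wreath_autT.
by apply/wreathP; exists b, a.
Qed.

(** * Uniserial groups and the groups E_n *)

Section ChiefSeries.

Variables (gT : finGroupType) (G : {group gT}).
Hypothesis G_chain : forall N M : {group gT}, N <| G -> M <| G ->
  (N \subset M) || (M \subset N).

(** Two chief factors above V are comparable, so equal by minimality. *)
Lemma chief_factor_unique (V U1 U2 : {group gT}) :
  chief_factor G V U1 -> chief_factor G V U2 -> U1 = U2.
Proof.
wlog sU12 : U1 U2 / U1 \subset U2 => [IH ch1 ch2|].
  have [nsU1 nsU2] := (andP ch1, andP ch2).
  by case/orP: (G_chain nsU1.2 nsU2.2) => ?; [|symmetry]; apply: IH.
case/andP=> max1 nsU1 /andP[max2 nsU2]; apply/val_inj/eqP => /=.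
rewrite eqEproper sU12 /=; apply/negP=> prU12.
have /andP[prVU1 _] := maxgroupp max1.
have /maxgroupP[_ maxV] := max2; have := maxV U1.
rewrite prU12 (normal_norm nsU1) => /(_ isT (proper_sub prVU1)) eqU1.
by rewrite eqU1 properxx in prVU1.
Qed.

Lemma chief_factor_total (U : {group gT}) : ~~ chief_factor G G U.
Proof.
apply/negP=> /andP[/maxgroupp/andP[prGU _] nsUG].
by have := proper_sub_trans prGU (normal_sub nsUG); rewrite properxx.
Qed.

Lemma chief_series_unique (V : {group gT}) r1 r2 :
    (G.-chief).-series V r1 -> (G.-chief).-series V r2 ->
  last V r1 = G -> last V r2 = G -> r1 = r2.
Proof.
elim: r1 V r2 => [|U1 r1 IHr] V [|U2 r2] //=.
- by move=> _ /andP[chU _] VG; rewrite VG (negPf (chief_factor_total _)) in chU.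
- by move=> /andP[chU _] _ _ VG; rewrite VG (negPf (chief_factor_total _)) in chU.
case/andP=> ch1 s1 /andP[ch2]; rewrite -(chief_factor_unique ch1 ch2) => s2 l1 l2.
by congr (_ :: _); apply: IHr l1 l2.
Qed.

Lemma exists_unique_chief_series : exists! r, is_chief_series G r.
Proof.
have [r ser_r last_r] := chief_series_exists (normal_refl G).
exists (1%G :: r); split=> [|[|V r2] //].
  by rewrite is_chief_seriesE eqxx ser_r last_r /=.
rewrite is_chief_seriesE => /and3P[/eqP-> ser2 /eqP last2]; congr (_ :: _).
exact: chief_series_unique ser_r ser2 last_r last2.
Qed.

End ChiefSeries.

(** The properties that pass from G to its even wreath product. Unless [N, G] = N
    for the proper N, a normal subgroup P^d could not be recovered from
    commutators. The last clause of two_gen is the form in which generation uses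
    that y ^+ (2 * d.-1) moves the first level. *)
Record uniserial_2gen d n (G : {group {perm vertex d n.+1}}) : Prop := Uniserial2gen {
  normals_chain : forall N M : {group {perm vertex d n.+1}}, N <| G -> M <| G ->
    (N \subset M) || (M \subset N);
  normals_comm : forall N : {group {perm vertex d n.+1}}, N <| G ->
    N = G :> {set _} \/ (N \subset even_part G top_sgn) && (N \subset [~: N, G]);
  two_gen : exists w y, [/\ <<[set w; y]>> = G, w * w = 1, top_sgn w,
    top y = rot_perm d &
    forall N : {group {perm vertex d n.+1}}, N <| G ->
      y ^+ (2 * d.-1) \in N -> even_part G top_sgn \subset N] }.

Lemma autT_topM d n : {in autT d n.+1 &, {morph @top d n : g h / g * h}}.
Proof.
by move=> g h /autT_wr[b [_ ->]] /autT_wr[c [_ ->]]; rewrite wrM !top_wr.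
Qed.

Lemma top_sgn_morph_E d n :
  {in E d n.+1 &, {morph top_sgn : x y / x * y >-> x (+) y}}.
Proof.
move=> g h /(subsetP (E_sub_autT d n.+1)) Ag /(subsetP (E_sub_autT d n.+1)) Ah.
by rewrite autT_topM // odd_permM.
Qed.

Lemma uniserial_2gen_autT1 d (d_ge3 : 2 < d) : odd d -> uniserial_2gen (autT_group d 1).
Proof.
move=> d_odd; set G := autT_group d 1.
have d3 : 2 < #|'I_d| by rewrite card_ord.
have dO : odd #|'I_d| by rewrite card_ord.
pose emb (a : 'S_d) : {perm vertex d 1} := wr (fun=> 1) a.
have GE g : g \in G -> g = emb (top g).
  case/autT_wr=> b [_ {1}->]; apply: eq_wr => i; apply/permP=> u; apply: val_inj.
  have size0 (v : vertex d 0) : val v = [::].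
    by apply: size0nil; apply/eqP; rewrite -leqn0 size_bseq.
  by rewrite /= !size0.
have Gemb a : emb a \in autT d 1.
  by rewrite -wreath_autT; apply/wreathP; exists (fun=> 1), a.
have embM : {in [set: 'S_d] &, {morph emb : a b / a * b}}.
  by move=> a b _ _; rewrite /emb wrM; apply: eq_wr => i; rewrite mulg1.
pose f := Morphism (@autT_topM d 0).
have f_onto : f @* G = [set: 'S_d].
  apply/setP=> a; rewrite inE; apply/morphimP; exists (emb a); rewrite ?Gemb //=.
  by rewrite top_wr.
have ker1 : 'ker f = 1.
  apply/trivgP/subsetP=> g kg; have Gg := dom_ker kg; rewrite inE (GE g Gg).
  by have /= -> := mker kg; rewrite /emb wr1.
have sBN (N : {group {perm vertex d 1}}) : N <| G -> ~~ (N \subset 'ker f) -> 'ker f \subset N.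
  by rewrite ker1 sub1G.
have sgnM : {in G &, {morph top_sgn : x y / x * y >-> x (+) y}} := odd_morph f.
have above (N : {group {perm vertex d 1}}) (nsN : N <| G) :
    ~~ (N \subset 'ker f) -> even_part G top_sgn \subset N.
  by move=> nN; apply: (onto_sym_normal d3 dO f_onto nsN nN (sBN N nsN nN)).
split=> [N M nsN nsM|N nsN|].
- have [sN1 | nN1] := boolP (N \subset 'ker f).
    by rewrite (subset_trans sN1) // ker1 sub1G.
  have [sM1 | nM1] := boolP (M \subset 'ker f).
    by rewrite orbC (subset_trans sM1) // ker1 sub1G.
  have [->|->] := normal_above_even sgnM nsN (above N nsN nN1).
    by rewrite (normal_sub nsM) orbT.
  by rewrite above.
- have [sN1 | nN1] := boolP (N \subset 'ker f).
    right; rewrite ker1 in sN1; rewrite (trivgP sN1) sub1G.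
    by apply/andP; split=> //; apply: (sub1G (Group (group_set_even sgnM))).
  have [->|NK] := normal_above_even sgnM nsN (above N nsN nN1); [by left|right].
  by rewrite NK subxx (onto_sym_comm d3 dO f_onto sBN).
exists (emb (tperm (pt0 d_ge3) (pt1 d_ge3))), (emb (rot_perm d)); split.
- pose h := Morphism embM.
  have -> : G = h @* [set: 'S_d] :> {set _}.
    apply/setP=> g; apply/idP/morphimP=> [Gg|[a _ _ ->]]; last exact: Gemb.
    by exists (top g); rewrite ?inE //=; apply: GE.
  rewrite -[X in h @* X](gen_tperm_rot d_ge3) morphim_gen ?subsetT //.
  by rewrite morphimEsub ?subsetT // imsetU1 imset_set1.
- by rewrite -embM ?inE // tperm2 /emb wr1.
- by rewrite top_wr odd_tperm.
- exact: top_wr.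
move=> N nsN Ny; apply: above => //; apply/negP; rewrite ker1 => /subsetP/(_ _ Ny)/set1P.
move/(congr1 f); rewrite morph1 morphX ?Gemb //= top_wr; apply/eqP.
exact: rot_permX_neq1.
Qed.

Lemma uniserial_2gen_E d n : 2 < d -> odd d -> uniserial_2gen (E_group d n.+1).
Proof.
move=> d_ge3 d_odd; elim: n => [|n [chainE commE [w [y [gen_wy w2 s_w top_y above_y]]]]].
  have [? ? ?] := uniserial_2gen_autT1 d_ge3 d_odd; split; assumption.
have W_E : E_group d n.+2 = even_wreath (E_group d n.+1) top_sgn :> {set _}.
  exact: E_even_wreath.
have sM := @top_sgn_morph_E d n.
have Ew : w \in E_group d n.+1 by rewrite -gen_wy mem_gen // !inE eqxx.
have s_y : ~~ top_sgn y by rewrite top_y odd_rot_perm.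
split=> [N M|N|].
- exact: (even_wreath_normals_chain d_ge3 d_odd W_E sM Ew s_w commE chainE).
- exact: (even_wreath_normal_comm d_ge3 d_odd W_E sM Ew s_w commE).
exists (flip_gen w d_ge3), (rot_gen y d_ge3); split.
- exact: (even_wreath_gen d_ge3 d_odd W_E sM gen_wy w2 s_w s_y above_y).
- exact: flip_gen2.
- by rewrite top_wr odd_tperm.
- exact: top_wr.
move=> N nsN Ny; have Wy := rot_gen_mem d_ge3 d_odd W_E sM gen_wy s_y.
apply: (even_part_sub_normal d_ge3 d_odd W_E sM Ew s_w commE nsN Ny).
have := morphX (Morphism (top_morph W_E)) (2 * d.-1) Wy => /= ->.
by rewrite top_wr rot_permX_neq1.
Qed.

Theorem theorem1p2 (d n : nat) (d_ge3 : 3 <= d) (d_odd : odd d) (n_ge1 : 1 <= n) :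
  'm(E d n) = 2 /\
  exists! s : seq {group {perm vertex d n}}, is_chief_series (E_group d n) s.
Proof.
case: n n_ge1 => // n _; have [chainE commE [w [y [gen_wy _ s_w top_y above_y]]]] :=
  uniserial_2gen_E n d_ge3 d_odd.
split; last exact: exists_unique_chief_series.
apply/eqP; rewrite eqn_leq; apply/andP; split.
  rewrite -[E d n.+1]gen_wy (leq_trans (grank_min _)) // cards2.
  by case: eqP.
(* In a cyclic group y, which is in the even part, would be trivial. *)
rewrite ltnNge; apply/negP=> m_le1; have [B genB cardB] := grank_witness (E_group d n.+1).
have abE : abelian (E_group d n.+1).
  rewrite -genB; rewrite -cardB in m_le1.
  have [B0 | [x Bx]] := set_0Vmem B; first by rewrite B0 gen0 abelian1.
  suff -> : B = [set x] by apply: cycle_abelian.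
  by apply/esym/eqP; rewrite eqEcard sub1set Bx cards1.
have Ey : y \in E_group d n.+1 by rewrite -gen_wy mem_gen // !inE eqxx orbT.
have Ew : w \in E_group d n.+1 by rewrite -gen_wy mem_gen // !inE eqxx.
have sM := @top_sgn_morph_E d n.
case: (@commE (Group (group_set_even sM)) (even_part_normal sM)) => [/setP/(_ w)|].
  by rewrite !inE Ew s_w.
case/andP=> _ /subsetP/(_ y); rewrite inE Ey top_y odd_rot_perm // => /(_ isT).
rewrite (commG1P _); last by apply: subset_trans (normal_sub (even_part_normal sM)) abE.
move/set1P=> y1; have := rot_permX_neq1 d_ge3; rewrite -top_y y1.
by rewrite -wr1 top_wr expg1n eqxx.
Qed.
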